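(* Let $M$ be a CR-manifold belonging to general class ${\sf III_2}$. Let $P^5\to M$ be the associated principal bundle with structure group $G_5\cong\mathbb{R}\setminus\{0\}$, let $(\Lambda,\tau,\sigma,\rho,\zeta,\overline{\zeta})$ be its coframe of $1$-forms, and let $\mathfrak{g}$ be the $6$-dimensional Lie algebra with basis $(e_\alpha,e_\tau,e_\sigma,e_\rho,e_\zeta,e_{\overline\zeta})$, all as defined in the context. Let $\omega$ be the $\mathfrak{g}$-valued $1$-form on $P^5$ defined by $$\omega(X):=\Lambda(X)\,e_\alpha+\tau(X)\,e_\tau+\sigma(X)\,e_\sigma+\rho(X)\,e_\rho+\zeta(X)\,e_\zeta+\overline{\zeta}(X)\,e_{\overline{\zeta}},\qquad X\in T_pP^5 .$$ Then $\omega$ is a Cartan connection on $P^5$, that is: (1) $\omega(e_\alpha^* )=e_\alpha$, where $e_\alpha^*$ is the vertical vector field on $P^5$ generated by the action of $e_\alpha$; (2) $R_a^*\,\omega=\mathrm{Ad}(a^{-1})\,\omega$ for every $a$ in the structure group; (3) for each $p\in P^5$, $\omega_p:T_pP^5\to\mathfrak{g}$ is an isomorphism.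
   Context: **CR-manifolds of class ${\sf III_2}$.** A CR-manifold of CR-dimension $1$ is a smooth real manifold $M$ with a complex line subbundle $L\subset\mathbb{C}\otimes TM$ such that $L\cap\overline{L}=\{0\}$ (and $[L,L]\subset L$). Let $\mathcal{L}$ be a local generator of $L$, and put $\mathcal{T}:=i[\mathcal{L},\overline{\mathcal{L}}]$, $\mathcal{S}:=[\mathcal{L},\mathcal{T}]$, $\mathcal{R}:=[\mathcal{L},\mathcal{S}]$. $M$ belongs to general class ${\sf III_2}$ if $\dim M=5$ and, at every point, $\mathcal{L},\overline{\mathcal{L}},\mathcal{T}$ have rank $3$; $\mathcal{L},\overline{\mathcal{L}},\mathcal{T},\mathcal{S}$ have rank $4$; $\mathcal{L},\overline{\mathcal{L}},\mathcal{T},\mathcal{S},\overline{\mathcal{S}}$ have rank $4$; and $\mathcal{L},\overline{\mathcal{L}},\mathcal{T},\mathcal{S},\mathcal{R}$ have rank $5$ over $\mathbb{C}$. **Fundamental functions.** The generator $\mathcal{L}$ is chosen so that the dual coframe $\omega_0=(\tau_0,\sigma_0,\rho_0,\zeta_0,\overline{\zeta}_0)$ of $(\mathcal{R},\mathcal{S},\mathcal{T},\mathcal{L},\overline{\mathcal{L}})$ satisfies $d\zeta_0=0$ (for $M\subset\mathbb{C}^4$ a graph over coordinates $(z,u_1,u_2,u_3)$, $\mathcal{L}=\partial_z+A^1\partial_{u_1}+A^2\partial_{u_2}+A^3\partial_{u_3}$ is such a generator). Then there are functions $A,B,E,F,G,H,J,K$ with $\overline{\mathcal{S}}=A\,\mathcal{T}+B\,\mathcal{S}$,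 $[\mathcal{L},\mathcal{R}]=E\,\mathcal{T}+F\,\mathcal{S}+G\,\mathcal{R}$, $[\overline{\mathcal{L}},\mathcal{R}]=H\,\mathcal{T}+J\,\mathcal{S}+K\,\mathcal{R}$, and $B\overline{B}=1$. Fix a local smooth square root $B^{1/2}$. A vector field applied to a function means the derivative. **Auxiliary functions.** $$\mathbf{B}_0=\tfrac{3i}{10}\tfrac{\overline{\mathcal{L}}(B)}{B^{3/2}}-\tfrac{i}{5}\tfrac{A}{B^{1/2}}-\tfrac{i}{10}\tfrac{K}{B^{1/2}}-\tfrac{i}{10}\tfrac{\mathcal{L}(B)}{B^{1/2}},$$ $$\mathbf{C}_0=\tfrac{11}{20}\tfrac{\mathcal{L}(B)}{B^{1/2}}+\tfrac{3}{20}B^{1/2}G+\tfrac1{20}\tfrac{\overline{\mathcal{L}}(B)}{B^{3/2}}-\tfrac15\tfrac{A}{B^{1/2}}+\tfrac3{20}\tfrac{K}{B^{1/2}},$$ $$\mathbf{F}_0=\tfrac1{10}\tfrac{\mathcal{L}(B)}{B^{1/2}}+\tfrac3{10}B^{1/2}G+\tfrac1{10}\tfrac{\overline{\mathcal{L}}(B)}{B^{3/2}}-\tfrac25\tfrac{A}{B^{1/2}}+\tfrac3{10}\tfrac{K}{B^{1/2}},$$ $$\mathfrak{I}_1=\tfrac12\tfrac{\mathcal{L}(B)}{B^{1/2}}+\tfrac3{10}B^{1/2}G-\tfrac1{10}\tfrac{\overline{\mathcal{L}}(B)}{B^{3/2}}+\tfrac25\tfrac{A}{B^{1/2}}-\tfrac3{10}\tfrac{K}{B^{1/2}},$$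 $$\mathbf{D}_0=i\,\mathbf{B}_0^2-\tfrac{A\,\mathbf{B}_0}{B^{1/2}}+\tfrac{\overline{\mathcal{L}}(\mathbf{B}_0)}{B^{1/2}}+\tfrac12\tfrac{\overline{\mathcal{L}}(B)\,\mathbf{B}_0}{B^{3/2}},$$ $$\mathbf{G}_0=-\tfrac14\tfrac{\mathcal{L}(B)}{B^{1/2}}\mathbf{F}_0-\mathbf{F}_0^2+\tfrac12B^{1/2}G\,\mathbf{F}_0-\tfrac12B^{1/2}\mathcal{L}(\mathbf{F}_0)+\mathbf{C}_0\mathbf{F}_0+\tfrac12FB+\tfrac14\tfrac{\overline{\mathcal{L}}(B)}{B^{3/2}}\mathbf{F}_0+\tfrac12\tfrac{K}{B^{1/2}}\mathbf{F}_0-\tfrac12\tfrac{\overline{\mathcal{L}}(\mathbf{F}_0)}{B^{1/2}}+\tfrac{J}{2}-\tfrac12\tfrac{A}{B^{1/2}}\mathbf{F}_0,$$ $$\mathbf{H}_0=-\mathbf{D}_0\mathbf{F}_0+\mathbf{C}_0\mathbf{D}_0-\tfrac{\mathcal{L}(B)}{B^{1/2}}\mathbf{D}_0-\tfrac{A}{B^{1/2}}\mathbf{D}_0+\tfrac{\overline{\mathcal{L}}(\mathbf{D}_0)}{B^{1/2}}+i\,\mathbf{B}_0\mathbf{D}_0-i\,\mathbf{B}_0^2\mathbf{C}_0+\tfrac{A}{B^{1/2}}\mathbf{B}_0\mathbf{C}_0-\mathcal{L}(A)\,\mathbf{B}_0-\tfrac{\overline{\mathcal{L}}(\mathbf{B}_0)}{B^{1/2}}\mathbf{C}_0-\tfrac12\tfrac{\overline{\mathcal{L}}(B)}{B^{3/2}}\mathbf{B}_0\mathbf{C}_0.$$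 **The bundle $P^5$.** Put $\tau_1=\tau_0/B$, $\sigma_1=\sigma_0/B^{1/2}$, $\rho_1=\rho_0$, $\zeta_1=\zeta_0/B^{1/2}$, and then $\tau_4=\tau_1$, $\ \sigma_4=\sigma_1+\mathbf{F}_0\tau_1$, $\ \rho_4=\rho_1+\mathbf{C}_0\sigma_1+\mathbf{G}_0\tau_1$, $\ \zeta_4=\zeta_1+\mathbf{B}_0\rho_1+\mathbf{D}_0\sigma_4+\mathbf{H}_0\tau_1$, with $\overline{\zeta}_4$ the conjugate of $\zeta_4$; $\tau_4,\sigma_4,\rho_4$ are real. Let $\omega_4=(\tau_4,\sigma_4,\rho_4,\zeta_4,\overline{\zeta}_4)$ and $G_5=\{\mathrm{diag}({\sf a}^4,{\sf a}^3,{\sf a}^2,{\sf a},{\sf a}):{\sf a}\in\mathbb{R}\setminus\{0\}\}$. $P^5$ is the $G_5$-structure on $M$ whose restriction to the domain of $\mathcal{L}$ consists of the coframes $g\cdot\omega_4$, $g\in G_5$. In the local trivialization with fibre coordinate ${\sf a}$, the tautological forms on $P^5$ are $\tau={\sf a}^4\tau_4$, $\sigma={\sf a}^3\sigma_4$, $\rho={\sf a}^2\rho_4$, $\zeta={\sf a}\,\zeta_4$, $\overline{\zeta}={\sf a}\,\overline{\zeta}_4$. For ${\sf b}\in\mathbb{R}\setminus\{0\}\cong G_5$, $R_{\sf b}$ is the map ${\sf a}\mapsto{\sf a}{\sf b}$ on the fibres. **The form $\Lambda$.** $\Lambda$ is the modified Maurer–Cartan form $\Lambda=\frac{d{\sf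 a}}{{\sf a}}-X_\tau\tau-X_\sigma\sigma-X_\rho\rho-X_\zeta\zeta-X_{\overline\zeta}\overline\zeta$ on $P^5$ ($X_\bullet$ functions on $P^5$) which is uniquely determined by the following two features of the structure equations of $P^5$: (i) $d\tau-4\Lambda\wedge\tau-\frac{\mathfrak{I}_1}{{\sf a}}\,\tau\wedge\zeta+\frac{\mathfrak{I}_1}{{\sf a}}\,\tau\wedge\overline\zeta-\sigma\wedge\zeta-\sigma\wedge\overline\zeta$ is a function multiple of $\sigma\wedge\rho$; (ii) the expression of $d\sigma-3\Lambda\wedge\sigma$ in the $2$-forms built from $\tau,\sigma,\rho,\zeta,\overline\zeta$ has no $\tau\wedge\sigma$ term. **The Lie algebra $\mathfrak{g}$.** $\mathfrak{g}$ is the $6$-dimensional Lie algebra of infinitesimal CR-automorphisms of the model $w_1=\overline{w_1}+2iz\overline z$, $w_2=\overline{w_2}+2iz\overline z(z+\overline z)$, $w_3=\overline{w_3}+2iz\overline z(z^2+\frac32z\overline z+\overline z^2)$ in $\mathbb{C}^4$. It has basis $(e_\alpha,e_\tau,e_\sigma,e_\rho,e_\zeta,e_{\overline\zeta})$ (with $e_\alpha,e_\tau,e_\sigma,e_\rho$ real and $e_{\overline\zeta}$ the conjugate of $e_\zeta$; so $\mathfrak{g}$ is the real form of the complex span consisting of conjugation-invariant elements) and nonzero brackets $[e_\alpha,e_\tau]=-4e_\tau$, $[e_\alpha,e_\sigma]=-3e_\sigma$, $[e_\alpha,e_\rho]=-2e_\rho$, $[e_\alpha,e_\zeta]=-e_\zeta$,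 $[e_\alpha,e_{\overline\zeta}]=-e_{\overline\zeta}$, $[e_\sigma,e_\zeta]=[e_\sigma,e_{\overline\zeta}]=-e_\tau$, $[e_\rho,e_\zeta]=[e_\rho,e_{\overline\zeta}]=-e_\sigma$, $[e_\zeta,e_{\overline\zeta}]=-i\,e_\rho$. **Structure group.** The subalgebra $\mathfrak{g}_0=\mathbb{R}e_\alpha$ is the Lie algebra of the structure group $G_5\cong\mathbb{R}\setminus\{0\}$, with $\exp(s\,e_\alpha)$ corresponding to ${\sf a}=e^s$. Accordingly $\mathrm{Ad}({\sf a})$ acts on $\mathfrak{g}$ by $e_\alpha\mapsto e_\alpha$, $e_\tau\mapsto{\sf a}^{-4}e_\tau$, $e_\sigma\mapsto{\sf a}^{-3}e_\sigma$, $e_\rho\mapsto{\sf a}^{-2}e_\rho$, $e_\zeta\mapsto{\sf a}^{-1}e_\zeta$, $e_{\overline\zeta}\mapsto{\sf a}^{-1}e_{\overline\zeta}$. *)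

(* Defs.v *)
From HB Require Import structures.
From mathcomp Require Import all_boot all_order all_algebra.
From mathcomp Require Import all_classical all_reals all_analysis.
From mathcomp Require Import complex.

Set Implicit Arguments.
Unset Strict Implicit.
Unset Printing Implicit Defensive.

Import Order.TTheory GRing.Theory Num.Theory.
Import numFieldNormedType.Exports.

Local Open Scope classical_set_scope.
Local Open Scope ring_scope.

(* Vectors are rows and covectors are columns: the value of the covector al on
   the vector v is v *m al.  A 2-form is the skew matrix of its values on pairs
   of coordinate vectors. *)
Section Calculus.
Context {R : realType}.
Notation C := (R[i]).

Fixpoint Ck (k : nat) {n : nat} (U : set 'rV[R]_n) (f : 'rV[R]_n -> R) : Prop :=
  if k is k'.+1 then
    (forall x, U x -> differentiable f x) /\
    (forall v, Ck k' U (fun x => 'D_v f x))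
  else forall x, U x -> {for x, continuous f}.

Definition smooth_on {n : nat} (U : set 'rV[R]_n) (f : 'rV[R]_n -> R) :=
  forall k, Ck k U f.

Definition csmooth_on {n : nat} (U : set 'rV[R]_n) (f : 'rV[R]_n -> C) :=
  smooth_on U (fun x => complex.Re (f x)) /\
  smooth_on U (fun x => complex.Im (f x)).

Definition toC {m n : nat} (v : 'M[R]_(m, n)) : 'M[C]_(m, n) :=
  map_mx (real_complex R) v.

Definition conjmx {m n : nat} (v : 'M[C]_(m, n)) : 'M[C]_(m, n) :=
  map_mx (@conjc R) v.

Definition pd {n : nat} (j : 'I_n) (f : 'rV[R]_n -> C) (x : 'rV[R]_n) : C :=
  Complex ('D_(delta_mx 0 j) (fun y => complex.Re (f y)) x)
          ('D_(delta_mx 0 j) (fun y => complex.Im (f y)) x).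

(* sections of C (x) TR^n *)
Definition vfield n := 'rV[R]_n -> 'rV[C]_n.

Definition app {n : nat} (X : vfield n) (f : 'rV[R]_n -> C) (x : 'rV[R]_n) : C :=
  \sum_j X x 0 j * pd j f x.

Definition bracket {n : nat} (X Y : vfield n) : vfield n := fun x =>
  \row_j (app X (fun y => Y y 0 j) x - app Y (fun y => X y 0 j) x).

Definition conjv {n : nat} (X : vfield n) : vfield n := fun x => conjmx (X x).

Definition ext_d {n : nat} (al : 'rV[R]_n -> 'cV[C]_n) (x : 'rV[R]_n) : 'M[C]_n :=
  \matrix_(i, j) (pd i (fun y => al y j 0) x - pd j (fun y => al y i 0) x).

Definition wedge {n : nat} (u v : 'cV[C]_n) : 'M[C]_n := u *m v^T - v *m u^T.

Definition span_rank {n : nat} (s : seq 'rV[C]_n) : nat :=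
  \rank (\matrix_(i < size s) s`_i).

End Calculus.

(* [par c] is the inverse of [coord c]; only its values on
   [coord c @` dom c] matter.  The atlas need not be maximal. *)
Record smooth_manifold (R : realType) (n : nat) := SmoothManifold {
  carrier :> topologicalType;
  carrier_hausdorff : hausdorff_space carrier;
  carrier_second_countable : @second_countable carrier;
  chart : Type;
  dom : chart -> set carrier;
  coord : chart -> carrier -> 'rV[R]_n;
  par : chart -> 'rV[R]_n -> carrier;
  dom_open : forall c, open (dom c);
  dom_cover : forall p, exists c, dom c p;
  coordK : forall c p, dom c p -> par c (coord c p) = p;
  coord_open : forall c, open (coord c @` dom c);
  coord_continuous : forall c p, dom c p -> {for p, continuous (coord c)};
  par_continuous :
    forall c x, (coord c @` dom c) x -> {for x, continuous (par c)};
  transition_smooth : forall c c' j,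
    smooth_on (coord c @` (dom c `&` dom c'))
      (fun x => coord c' (par c x) 0 j)
}.

Section Manifold.
Context {R : realType} {n : nat} {M : smooth_manifold R n}.
Notation C := (R[i]).

(* the open subset of R^n that represents W in the chart c *)
Definition im (c : chart M) (W : set M) : set 'rV[R]_n :=
  coord c @` (dom c `&` W).

Definition transition (c c' : chart M) : 'rV[R]_n -> 'rV[R]_n :=
  fun x => coord c' (par c x).

Definition csmooth_fun (W : set M) (f : M -> C) :=
  forall c, csmooth_on (im c W) (fun x => f (par c x)).

(* A section of C (x) TM over W is given by its expression in each chart. *)
Definition is_cvfield (W : set M) (X : chart M -> vfield n) : Prop :=
  (forall c j, csmooth_on (im c W) (fun x => X c x 0 j)) /\
  (forall c c' p, W p -> dom c p -> dom c' p ->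
     X c' (coord c' p) =
     X c (coord c p) *m toC ('J (transition c c') (coord c p))).

(* [Lb p c] stands for the fibre at p of a subset of C (x) TM, expressed in
   the chart c (for p in the domain of c). *)
Definition is_section (Lb : M -> chart M -> set 'rV[C]_n) (W : set M)
    (X : chart M -> vfield n) : Prop :=
  is_cvfield W X /\
  (forall c p, W p -> dom c p -> Lb p c (X c (coord c p))).

Definition is_generator (Lb : M -> chart M -> set 'rV[C]_n) (W : set M)
    (X : chart M -> vfield n) : Prop :=
  is_cvfield W X /\
  (forall c p, W p -> dom c p ->
     X c (coord c p) != 0 /\
     Lb p c = [set v | exists z : C, v = z *: X c (coord c p)]).

End Manifold.

Record CR_structure (R : realType) (n : nat) (M : smooth_manifold R n) :=
  CRStructure {
  fibre :> M -> chart M -> set 'rV[R[i]]_n;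
  fibre_line : forall p : M, exists W X,
    [/\ open W, W p & is_generator fibre W X];
  fibre_conj : forall (p : M) c v, dom c p ->
    fibre p c v -> fibre p c (conjmx v) -> v = 0;
  fibre_involutive : forall (W : set M) X Y, open W ->
    is_section fibre W X -> is_section fibre W Y ->
    forall c p, W p -> dom c p ->
      fibre p c (bracket (X c) (Y c) (coord c p))
}.

Section Frame.
Context {R : realType} {n : nat}.
Notation C := (R[i]).
Variable vL : @vfield R n.

Definition vT : vfield n := fun x => 'i%C *: bracket vL (conjv vL) x.
Definition vS : vfield n := bracket vL vT.
Definition vR : vfield n := bracket vL vS.

Definition frame (x : 'rV[R]_n) : 'M[C]_(5, n) :=
  \matrix_(i < 5)
    [:: vR x; vS x; vT x; vL x; conjv vL x]`_i.

End Frame.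

Definition class_III2 (R : realType) (M : smooth_manifold R 5)
    (L : CR_structure M) : Prop :=
  forall (W : set M) X, open W -> is_generator L W X ->
  forall c x, im c W x ->
  let vL := X c in
  [/\ span_rank [:: vL x; conjv vL x; vT vL x] = 3%N,
      span_rank [:: vL x; conjv vL x; vT vL x; vS vL x] = 4%N,
      span_rank [:: vL x; conjv vL x; vT vL x; vS vL x; conjv (vS vL) x] = 4%N
    & span_rank [:: vL x; conjv vL x; vT vL x; vS vL x; vR vL x] = 5%N].

Section Local.
Context {R : realType}.
Notation C := (R[i]).
Notation fn := ('rV[R]_5 -> C).
Notation form := ('rV[R]_5 -> 'cV[C]_5).

(* A generator, its fundamental functions and a square root of B, all read
   in a chart. *)
Record local_data := LocalData {
  vL : @vfield R 5;
  fA : fn; fB : fn; fE : fn; fF : fn; fG : fn; fH : fn; fJ : fn; fK : fn;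
  sqB : fn }.

Variable d : local_data.
Local Notation L f := (app (vL d) f).
Local Notation Lb f := (app (conjv (vL d)) f).
Local Notation A := (fA d).
Local Notation B := (fB d).
Local Notation F := (fF d).
Local Notation G := (fG d).
Local Notation J := (fJ d).
Local Notation K := (fK d).
Local Notation s := (sqB d).              (* B^(1/2) *)
Local Notation B32 x := (B x * s x).      (* B^(3/2) *)
Local Notation i := ('i%C : C).

(* columns of the inverse matrix = forms dual to the rows of [frame] *)
Definition tau0   : form := fun x => col 0 (invmx (frame (vL d) x)).
Definition sigma0 : form := fun x => col 1 (invmx (frame (vL d) x)).
Definition rho0   : form := fun x => col 2%:R (invmx (frame (vL d) x)).
Definition zeta0  : form := fun x => col 3%:R (invmx (frame (vL d) x)).

Definition structure_equations (x : 'rV[R]_5) : Prop :=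
  let vT := vT (vL d) in let vS := vS (vL d) in let vR := vR (vL d) in
  [/\ ext_d zeta0 x = 0,
      conjv vS x = A x *: vT x + B x *: vS x,
      bracket (vL d) vR x = fE d x *: vT x + F x *: vS x + G x *: vR x,
      bracket (conjv (vL d)) vR x =
        fH d x *: vT x + J x *: vS x + K x *: vR x
    & s x ^+ 2 = B x].

Definition aB0 : fn := fun x =>
  3 / 10 * i * (Lb B x / B32 x) - i / 5 * (A x / s x)
  - i / 10 * (K x / s x) - i / 10 * (L B x / s x).

Definition aC0 : fn := fun x =>
  11 / 20 * (L B x / s x) + 3 / 20 * (s x * G x) + 1 / 20 * (Lb B x / B32 x)
  - 1 / 5 * (A x / s x) + 3 / 20 * (K x / s x).

Definition aF0 : fn := fun x =>
  1 / 10 * (L B x / s x) + 3 / 10 * (s x * G x) + 1 / 10 * (Lb B x / B32 x)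
  - 2 / 5 * (A x / s x) + 3 / 10 * (K x / s x).

Definition I1 : fn := fun x =>
  1 / 2 * (L B x / s x) + 3 / 10 * (s x * G x) - 1 / 10 * (Lb B x / B32 x)
  + 2 / 5 * (A x / s x) - 3 / 10 * (K x / s x).

Definition aD0 : fn := fun x =>
  i * aB0 x ^+ 2 - A x * aB0 x / s x + Lb aB0 x / s x
  + 1 / 2 * (Lb B x * aB0 x / B32 x).

Definition aG0 : fn := fun x =>
  - (1 / 4 * (L B x / s x) * aF0 x) - aF0 x ^+ 2
  + 1 / 2 * (s x * G x * aF0 x) - 1 / 2 * (s x * L aF0 x)
  + aC0 x * aF0 x + 1 / 2 * (F x * B x)
  + 1 / 4 * (Lb B x / B32 x) * aF0 x + 1 / 2 * (K x / s x) * aF0 x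
  - 1 / 2 * (Lb aF0 x / s x) + J x / 2 - 1 / 2 * (A x / s x) * aF0 x.

Definition aH0 : fn := fun x =>
  - (aD0 x * aF0 x) + aC0 x * aD0 x - L B x / s x * aD0 x
  - A x / s x * aD0 x + Lb aD0 x / s x + i * aB0 x * aD0 x
  - i * aB0 x ^+ 2 * aC0 x + A x / s x * aB0 x * aC0 x
  - L A x * aB0 x - Lb aB0 x / s x * aC0 x
  - 1 / 2 * (Lb B x / B32 x) * aB0 x * aC0 x.

Definition tau1   : form := fun x => (B x)^-1 *: tau0 x.
Definition sigma1 : form := fun x => (s x)^-1 *: sigma0 x.
Definition rho1   : form := rho0.
Definition zeta1  : form := fun x => (s x)^-1 *: zeta0 x.

Definition tau4   : form := tau1.
Definition sigma4 : form := fun x => sigma1 x + aF0 x *: tau1 x.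
Definition rho4   : form := fun x =>
  rho1 x + aC0 x *: sigma1 x + aG0 x *: tau1 x.
Definition zeta4  : form := fun x =>
  zeta1 x + aB0 x *: rho1 x + aD0 x *: sigma4 x + aH0 x *: tau1 x.

(* the coframe omega_4; its j-th column is its j-th form *)
Definition omega4 (x : 'rV[R]_5) : 'M[C]_5 :=
  \matrix_(k, j)
    ([:: tau4 x; sigma4 x; rho4 x; zeta4 x; conjmx (zeta4 x)]`_j) k 0.

(* the element of G_5 with parameter a; coframes being stored by columns,
   it acts by multiplication on the right *)
Definition G5 (a : R) : 'M[C]_5 :=
  diag_mx (\row_(j < 5) (a%:C%C ^+ nth 0 [:: 4; 3; 2; 1; 1] j)).

End Local.

Record generator_data (R : realType) (M : smooth_manifold R 5) := GeneratorData {
  gdom : set M;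
  gvL : chart M -> @vfield R 5;
  gA : M -> R[i]; gB : M -> R[i]; gE : M -> R[i]; gF : M -> R[i];
  gG : M -> R[i]; gH : M -> R[i]; gJ : M -> R[i]; gK : M -> R[i];
  gsqB : M -> R[i]
}.

Definition in_chart (R : realType) (M : smooth_manifold R 5)
    (D : generator_data M) (c : chart M) : local_data :=
  let pull f := fun x => f (par c x) in
  LocalData (gvL D c) (pull (gA D)) (pull (gB D)) (pull (gE D)) (pull (gF D))
    (pull (gG D)) (pull (gH D)) (pull (gJ D)) (pull (gK D)) (pull (gsqB D)).

Record adapted_generator (R : realType) (M : smooth_manifold R 5)
    (L : CR_structure M) := AdaptedGenerator {
  gdata :> generator_data M;
  gdom_open : open (gdom gdata);
  gvL_generator : is_generator L (gdom gdata) (gvL gdata);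
  gfun_smooth :
    let smooth := csmooth_fun (gdom gdata) in
    [/\ smooth (gA gdata), smooth (gB gdata), smooth (gE gdata),
        smooth (gF gdata) & smooth (gG gdata)] /\
    [/\ smooth (gH gdata), smooth (gJ gdata), smooth (gK gdata)
      & smooth (gsqB gdata)];
  gstructure : forall c x, im c (gdom gdata) x ->
    structure_equations (in_chart gdata c) x
}.

Section Bundle.
Context {R : realType} {M : smooth_manifold R 5} {L : CR_structure M}.
Notation C := (R[i]).

(* A complex coframe at a point of M, given by its matrix in each chart; the
   matrix is 0 by convention in the charts which do not contain the point. *)
Definition coframe_pt : Type := (M * (chart M -> 'M[C]_5))%type.

(* the coframe g . omega_4 at p, g the element of G_5 with parameter a *)
Definition coframe (D : adapted_generator L) (a : R) (p : M) : coframe_pt :=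
  (p, fun c => if `[< dom c p >]
               then omega4 (in_chart D c) (coord c p) *m G5 a else 0).

(* R_b; on the coframes g . omega_4 it is a |-> a b *)
Definition act (b : R) (u : coframe_pt) : coframe_pt :=
  (u.1, fun c => u.2 c *m G5 b).

Section Family.
(* a family of adapted generators, whose domains are to cover M *)
Context {I : Type}.
Variable D : I -> adapted_generator L.

(* The values at a point of M of P^5 do not depend on the chosen generators, so
   that any covering family of them describes the same P^5; every coframe of P^5
   is real in the sense that tau, sigma, rho are real, which is a consequence of
   the definitions and is not required here. *)
Definition is_P5 (P : set coframe_pt) : Prop :=
  (forall p, exists k, gdom (D k) p) /\
  (forall k (u : coframe_pt), gdom (D k) u.1 ->
     P u <-> exists2 a : R, a != 0 & u = coframe (D k) a u.1).

(* The charts of P^5: a chart c of M together with the trivialization over the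
   domain of a generator; the coordinates are (x, a) in R^5 x R. *)
Definition Pchart : Type := (chart M * I)%type.

Definition Pdom (k : Pchart) (u : coframe_pt) : Prop :=
  dom k.1 u.1 /\ gdom (D k.2) u.1.

Definition fibre_coord (k : I) (u : coframe_pt) : R :=
  xget 0 [set a : R | a != 0 /\ u = coframe (D k) a u.1].

Definition xP (y : 'rV[R]_(5 + 1)) : 'rV[R]_5 := lsubmx y.
Definition aP (y : 'rV[R]_(5 + 1)) : R := rsubmx y 0 0.

Definition Pcoord (k : Pchart) (u : coframe_pt) : 'rV[R]_(5 + 1) :=
  row_mx (coord k.1 u.1) (fibre_coord k.2 u)%:M.

Definition Ppar (k : Pchart) (y : 'rV[R]_(5 + 1)) : coframe_pt :=
  coframe (D k.2) (aP y) (par k.1 (xP y)).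

Definition Pim (k : Pchart) : set 'rV[R]_(5 + 1) :=
  [set y | im k.1 (gdom (D k.2)) (xP y) /\ aP y != 0].

(* complex-valued smooth 1-forms on P, given by their expression in charts *)
Definition is_oneform (P : set coframe_pt)
    (al : Pchart -> 'rV[R]_(5 + 1) -> 'cV[C]_(5 + 1)) : Prop :=
  (forall k j, csmooth_on (Pim k) (fun y => al k y j 0)) /\
  (forall k k' u, P u -> Pdom k u -> Pdom k' u ->
     al k (Pcoord k u) =
     toC ('J (fun y => Pcoord k' (Ppar k y)) (Pcoord k u))
       *m al k' (Pcoord k' u)).

(* the tautological forms (tau, sigma, rho, zeta, zetabar) as columns *)
Definition taut_mx (k : Pchart) (y : 'rV[R]_(5 + 1)) : 'M[C]_(5 + 1, 5) :=
  col_mx (omega4 (in_chart (D k.2) k.1) (xP y) *m G5 (aP y)) 0.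

Definition taut (k : Pchart) (j : 'I_5) (y : 'rV[R]_(5 + 1)) : 'cV[C]_(5 + 1) :=
  col j (taut_mx k y).

Definition form_da : 'cV[C]_(5 + 1) := col_mx 0 1.

Section Features.
Variable Lam : Pchart -> 'rV[R]_(5 + 1) -> 'cV[C]_(5 + 1).
Variable k : Pchart.

Local Notation tau := (taut k 0).
Local Notation sigma := (taut k 1).
Local Notation rho := (taut k 2%:R).
Local Notation zeta := (taut k 3%:R).
Local Notation zetab := (taut k 4%:R).

Definition modified_MC : Prop := forall y, Pim k y ->
  exists X : 'cV[C]_5,
    Lam k y = ((aP y)%:C%C)^-1 *: form_da - taut_mx k y *m X.

Definition feature_dtau : Prop := forall y, Pim k y ->
  let I1a := I1 (in_chart (D k.2) k.1) (xP y) / (aP y)%:C%C in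
  exists f : C,
    ext_d tau y - 4 *: wedge (Lam k y) (tau y)
    - I1a *: wedge (tau y) (zeta y) + I1a *: wedge (tau y) (zetab y)
    - wedge (sigma y) (zeta y) - wedge (sigma y) (zetab y)
    = f *: wedge (sigma y) (rho y).

Definition feature_dsigma : Prop := forall y, Pim k y ->
  exists2 f : 'I_5 -> 'I_5 -> C, f 0 1 = 0 &
    ext_d sigma y - 3 *: wedge (Lam k y) (sigma y) =
    \sum_(i < 5) \sum_(j < 5 | (i < j)%N) f i j *: wedge (taut k i y) (taut k j y).

End Features.

(* By the last two conditions, Lam is determined in each chart. *)
Definition is_Lambda (P : set coframe_pt)
    (Lam : Pchart -> 'rV[R]_(5 + 1) -> 'cV[C]_(5 + 1)) : Prop :=
  is_oneform P Lam /\
  (forall k, [/\ modified_MC Lam k, feature_dtau Lam k & feature_dsigma Lam k]).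

End Family.
End Bundle.

Section LieAlgebra.
Context {R : realType}.
Notation C := (R[i]).

(* the complexification of g, in the basis
   (e_alpha, e_tau, e_sigma, e_rho, e_zeta, e_zetabar) *)
Definition gC := 'rV[C]_(1 + 5).

Definition e_ (j : nat) : gC := delta_mx 0 (inord j : 'I_(1 + 5)).
Definition e_alpha : gC := e_ 0.

Definition half_bracket (j k : nat) : gC :=
  match j, k with
  | 0%N, 1%N => - 4 *: e_ 1 | 0%N, 2%N => - 3 *: e_ 2 | 0%N, 3%N => - 2 *: e_ 3
  | 0%N, 4%N => - e_ 4 | 0%N, 5%N => - e_ 5
  | 2%N, 4%N => - e_ 1 | 2%N, 5%N => - e_ 1
  | 3%N, 4%N => - e_ 2 | 3%N, 5%N => - e_ 2
  | 4%N, 5%N => - 'i%C *: e_ 3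
  | _, _ => 0
  end.

Definition g_bracket (v w : gC) : gC :=
  \sum_(j < 6) \sum_(k < 6)
    (v 0 j * w 0 k) *: (half_bracket j k - half_bracket k j).

(* conjugation exchanges e_zeta and e_zetabar and fixes the other basis
   vectors; g is its set of fixed points *)
Definition g_conj (v : gC) : gC :=
  \row_(j < 6) (v 0 (inord (nth 0 [:: 0; 1; 2; 3; 5; 4] j)%N))^*%C.

Definition in_g (v : gC) : Prop := g_conj v = v.

Definition wt (j : nat) : nat := nth 0%N [:: 0; 4; 3; 2; 1; 1]%N j.

Definition Ad (a : R) (v : gC) : gC :=
  \row_(j < 6) (a%:C%C ^- wt j * v 0 j).

Lemma Ad_sum (a:R) (I:finType) (P : pred I) (F : I -> gC) : Ad a (\sum_(i|P i) F i) = \sum_(i|P i) Ad a (F i).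
Proof. apply/rowP=> j; rewrite mxE !summxE mulr_sumr; by apply: eq_bigr=> i _; rewrite mxE. Qed.

Lemma AdZ a (c:C) (v : gC) : Ad a (c *: v) = c *: Ad a v.
Proof. by apply/rowP=> j; rewrite !mxE mulrCA. Qed.

Lemma Ade a m : (m < 6)%N -> Ad a (e_ m) = (a%:C%C ^- wt m) *: e_ m.
Proof. move=> hm; apply/rowP=> j; rewrite !mxE eqxx /=. case: eqP => [->|_]; last by rewrite !mulr0. by rewrite inordK. Qed.

Lemma Adhalf (a : R) j k : a != 0 -> (j < 6)%N -> (k < 6)%N ->
  Ad a (half_bracket j k) = (a%:C%C ^- wt j * a%:C%C ^- wt k) *: half_bracket j k.
Proof.
move=> a0.
have a0' : a%:C%C != 0 :> C by rewrite fmorph_eq0.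
have H0 (c : C) : Ad a (0 : gC) = c *: 0.
  by rewrite scaler0; apply/rowP=> i; rewrite !mxE mulr0.
have HZ m n p (c : C) : (p < 6)%N -> wt p = (wt m + wt n)%N ->
    Ad a (c *: e_ p) = (a%:C%C ^- wt m * a%:C%C ^- wt n) *: (c *: e_ p).
  by move=> p6 E; rewrite AdZ Ade // E exprD invfM !scalerA mulrC.
have HN m n p : (p < 6)%N -> wt p = (wt m + wt n)%N ->
    Ad a (- e_ p) = (a%:C%C ^- wt m * a%:C%C ^- wt n) *: (- e_ p).
  by rewrite -scaleN1r; exact: HZ.
by case: j => [|[|[|[|[|[|j]]]]]]; case: k => [|[|[|[|[|[|k]]]]]] // _ _;
  first [exact: H0 | exact: HZ | exact: HN].
Qed.

Lemma Ad_bracket (a : R) (v w : gC) : a != 0 ->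
  g_bracket (Ad a v) (Ad a w) = Ad a (g_bracket v w).
Proof.
move=> a0; rewrite /g_bracket Ad_sum; apply: eq_bigr => j _.
rewrite Ad_sum; apply: eq_bigr => k _.
have AdB x y : Ad a (x - y) = Ad a x - Ad a y :> gC.
  by apply/rowP=> l; rewrite !mxE mulrBr.
rewrite AdZ AdB !Adhalf // [_ ^- wt k * _]mulrC -scalerBr scalerA.
by rewrite !mxE mulrACA mulrC.
Qed.

(* the infinitesimal form of Ad (e^s) = exp (s ad e_alpha) *)
Lemma g_bracket_alpha (v : gC) :
  g_bracket e_alpha v = - \row_(j < 6) ((wt j)%:R * v 0 j).
Proof.
have E (j : 'I_6) : e_alpha 0 j = (j == ord0)%:R :> C.
  rewrite /e_alpha /e_ mxE eqxx /=; congr (_ %:R); congr nat_of_bool.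
  by congr (_ == _); apply: val_inj; rewrite /= inordK.
have H (k : 'I_6) : half_bracket 0 k - half_bracket k 0 = - ((wt k)%:R *: e_ k).
  case: k => k k6; change (nat_of_ord (Ordinal k6)) with k.
  case: k k6 => [|[|[|[|[|[|k]]]]]] // _; rewrite [X in _ - X]/half_bracket subr0 /half_bracket.
  - by rewrite scale0r oppr0.
  - by rewrite scaleNr.
  - by rewrite scaleNr.
  - by rewrite scaleNr.
  - by rewrite scale1r.
  - by rewrite scale1r.
rewrite /g_bracket (bigD1 ord0) //= [X in _ + X]big1 ?addr0; last first.
  by move=> j /negPf j0; rewrite big1 // => k _; rewrite E j0 mul0r scale0r.
rewrite [X in _ = - X]row_sum_delta -sumrN; apply: eq_bigr => k _.
by rewrite E eqxx mul1r H mxE scalerN scalerA mulrC /e_ inord_val.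
Qed.

End LieAlgebra.

Section Cartan.
Context {R : realType} {M : smooth_manifold R 5} {L : CR_structure M} {I : Type}.
Variable D : I -> adapted_generator L.
Notation C := (R[i]).

(* the form Lambda e_alpha + tau e_tau + ... + zetabar e_zetabar in the chart k,
   evaluated at the point y on the real tangent vector v *)
Definition cartan_form (Lam : Pchart -> 'rV[R]_(5 + 1) -> 'cV[C]_(5 + 1))
    (k : Pchart) (y : 'rV[R]_(5 + 1)) (v : 'rV[R]_(5 + 1)) : gC :=
  toC v *m row_mx (Lam k y) (taut_mx D k y).

(* R_b read in the chart k, whose domain it preserves *)
Definition R_chart (k : Pchart) (b : R) (y : 'rV[R]_(5 + 1)) : 'rV[R]_(5 + 1) :=
  Pcoord D k (act b (Ppar D k y)).

(* e_alpha^* at u: the velocity at s = 0 of s |-> u . exp (s e_alpha), where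
   exp (s e_alpha) has parameter e^s *)
Definition e_alpha_star (k : Pchart) (u : coframe_pt) : 'rV[R]_(5 + 1) :=
  \row_j derive1 (fun s : R => Pcoord D k (act (expR s) u) 0 j) 0.

Definition cartan_connection (P : set (@coframe_pt R M))
    (om : Pchart -> 'rV[R]_(5 + 1) -> 'rV[R]_(5 + 1) -> @gC R) : Prop :=
  forall k u, P u -> Pdom D k u ->
  let y := Pcoord D k u in
  [/\ forall v, in_g (om k y v),
      om k y (e_alpha_star k u) = e_alpha,
      forall b : R, b != 0 -> forall v,
        om k (Pcoord D k (act b u)) (v *m 'J (R_chart k b) y)
        = Ad b^-1 (om k y v)
    & [/\ forall (t : R) v w,
            om k y (t *: v + w) = t%:C%C *: om k y v + om k y w
        & forall xi : gC, in_g xi -> exists! v, om k y v = xi]].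

End Cartan.

(* Main.v *)
From mathcomp Require Import all_boot all_order all_algebra.
From mathcomp Require Import all_classical all_reals all_analysis.
From mathcomp Require Import perm complex ring lra.
Require Import Defs.

Set Implicit Arguments.
Unset Strict Implicit.
Unset Printing Implicit Defensive.

Import Order.TTheory GRing.Theory Num.Theory.
Import numFieldNormedType.Exports.

Local Open Scope classical_set_scope.
Local Open Scope ring_scope.

(** Conjugating the structure equations (with the Jacobi identity) gives
    B conj(B) = 1 and formulas for conj(A), conj(F), conj(G), conj(J), conj(K);
    they show that tau_4, sigma_4, rho_4 are real and that I_1 is imaginary.
    Modulo da, feature (i) divided by a^4 and feature (ii) divided by a^3 no
    longer involve a, and they are linear equations for the coordinates of
    da/a - Lambda in the coframe omega_4.  Hence Lambda = da/a - beta for a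
    1-form beta on M, which is real because its coordinates are explicit in
    d tau_4, d sigma_4 and I_1.  All three properties of a Cartan connection can
    then be read off, since in a trivialization the right action is
    (x, a) |-> (x, a b). *)

(** * Smooth functions of real variables *)

(** The obstacle is reality, which both the values in g and the bijectivity on real tangent spaces
    require. Since zetabar_4 is by definition the conjugate of zeta_4, reality of the coframe says
    that conjugation multiplies the matrix of omega_4 on the right by the permutation matrix of
    [swap_zeta]. The coefficients B^(1/2), F_0, C_0, G_0 are not real: conjugation replaces the
    frame by conj(R) = B^2 R + r_S S + r_T T and conj(S) = A T + B S, and each coefficient has to
    change by exactly the amount that compensates this. For G_0, which contains derivatives of F_0,
    the relation for conj(F_0) must itself be differentiated, so relations are kept on open sets and
    not only at points. The denominators of F_0, C_0, G_0 and I_1 are powers of B^(1/2), which has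
    modulus 1; inverses are therefore conjugates, and smoothness and derivatives of quotients reduce
    to those of products. The Jacobi identity rests on the symmetry of second derivatives, obtained
    here directly from [Ck]. *)

Section NearEqDiff.
Variables (R : numFieldType) (V W : normedModType R).

Lemma near_eq_diff_locally (f g : V -> W) (a : V) :
  {near a, f =1 g} -> differentiable f a ->
  g \o shift a = cst (g a) + 'd f a +o_ (0 : V) id.
Proof.
move=> fg df; apply/eqaddoP => e e0.
have fga : f a = g a by exact: nbhs_singleton fg.
have /eqaddoP/(_ e e0) H := diff_locally df.
have fg' : \forall h \near (0 : V), f (h + a) = g (h + a).
  by move: fg; rewrite (near_shift 0) /= subr0.
apply: filterS2 fg' H => h; rewrite /GRing.opp /GRing.add /= /cst fga.
by rewrite /GRing.add /= => ->.
Qed.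

Lemma near_eq_diff (f g : V -> W) (a : V) :
  {near a, f =1 g} -> differentiable f a -> 'd g a = 'd f a :> (V -> W).
Proof.
move=> fg df; apply: diff_unique; last exact: near_eq_diff_locally.
exact: diff_continuous.
Qed.

Lemma near_eq_differentiable (f g : V -> W) (a : V) :
  {near a, f =1 g} -> differentiable f a -> differentiable g a.
Proof.
move=> fg df; apply/diff_locallyP; rewrite (near_eq_diff fg df).
by split; [exact: diff_continuous|exact: near_eq_diff_locally].
Qed.

End NearEqDiff.

Section RealSmooth.
Context {R : realType} {n : nat}.
Implicit Types (U : set 'rV[R]_n) (f g : 'rV[R]_n -> R).

Lemma open_near (T : Type) U (f g : 'rV[R]_n -> T) x :
  open U -> U x -> {in U, f =1 g} -> {near x, f =1 g}.
Proof.
move=> oU Ux fg; have := open_nbhs_nbhs (conj oU Ux).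
by apply: filterS => y Uy; apply: fg; rewrite inE.
Qed.

(** On an open set a derivative sees only the germ of the function, although [Ck] speaks of total
    functions. Identities valid only on [U] can thus be used under derivatives. *)
Lemma eq_Ck k U f g : open U -> {in U, f =1 g} -> Ck k U f -> Ck k U g.
Proof.
move=> oU; elim: k f g => [|k IH] f g fg /=.
  move=> cf x Ux; have fgx := open_near oU Ux fg.
  have := cvg_trans (@near_eq_cvg _ _ (nbhs x) _ _ _ fgx) (cf x Ux).
  by rewrite fg ?inE//; apply.
case=> df Df; split=> [x Ux|v].
  by apply: near_eq_differentiable (df x Ux); exact: (open_near oU).
apply: IH (Df v) => x; rewrite inE => Ux.
by apply: near_eq_derive; exact: (open_near oU).
Qed.

Lemma CkW k U f : Ck k.+1 U f -> Ck k U f.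
Proof.
elim: k f => [|k IH] f [df Df]; last by split=> // v; exact/IH/Df.
by move=> x Ux; exact/differentiable_continuous/df.
Qed.

Lemma Ck_cst k U (a : R) : Ck k U (fun=> a).
Proof.
elim: k a => [|k IH] a /=; first by move=> x _; apply: cst_continuous.
split=> [x _|v]; first exact: differentiable_cst.
suff -> : 'D_v (fun=> a) = (fun=> 0) :> ('rV[R]_n -> R) by [].
by apply/funext => x; exact: derive_cst.
Qed.

Lemma CkD k U f g : open U -> Ck k U f -> Ck k U g -> Ck k U (fun x => f x + g x).
Proof.
move=> oU; elim: k f g => [|k IH] f g /=.
  by move=> cf cg x Ux; exact: cvgD (cf x Ux) (cg x Ux).
case=> df Df [dg Dg]; split=> [x Ux|v].
  by apply: differentiableD; [exact: df|exact: dg].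
apply: eq_Ck (IH _ _ (Df v) (Dg v)) => // x; rewrite inE => Ux.
by rewrite deriveD //; apply: diff_derivable; [exact: df|exact: dg].
Qed.

Lemma CkM k U f g : open U -> Ck k U f -> Ck k U g -> Ck k U (fun x => f x * g x).
Proof.
move=> oU; elim: k f g => [|k IH] f g.
  by move=> cf cg x Ux; exact: cvgM (cf x Ux) (cg x Ux).
move=> Cf Cg; have [df Df] := Cf; have [dg Dg] := Cg; split=> [x Ux|v].
  by apply: differentiableM; [exact: df|exact: dg].
apply: eq_Ck (CkD oU (IH _ _ (CkW Cf) (Dg v)) (IH _ _ (CkW Cg) (Df v))) => //.
move=> x; rewrite inE => Ux.
by rewrite deriveM //; apply: diff_derivable; [exact: df|exact: dg].
Qed.

Lemma smooth_derive U f v : smooth_on U f -> smooth_on U (fun x => 'D_v f x).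
Proof. by move=> sf k; have [_] := sf k.+1; exact. Qed.

Lemma smooth_differentiable U f x : smooth_on U f -> U x -> differentiable f x.
Proof. by move=> sf; have [+ _] := sf 1; exact. Qed.

Lemma smooth_derivable U f x v : smooth_on U f -> U x -> derivable f x v.
Proof. by move=> sf Ux; exact/diff_derivable/(smooth_differentiable sf). Qed.

End RealSmooth.

(** * Symmetry of second derivatives *)

Section SymmetricSecondDerivative.
Context {R : realType} {n : nat}.
Implicit Types (U : set 'rV[R]_n) (f : 'rV[R]_n -> R).

Lemma line_growth f (y u : 'rV[R]_n) (s : R) :
  (fun h : R => h^-1 *: ((fun t => f (y + t *: u)) (h *: 1 + s) - f (y + s *: u)))
  = (fun h : R => h^-1 *: (f (h *: u + (y + s *: u)) - f (y + s *: u))).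
Proof.
apply/funext => h; congr (_ *: (f _ - _)).
by rewrite scalerDl /GRing.scale /= mulr1 addrCA.
Qed.

Lemma is_derive_line f (y u : 'rV[R]_n) (s : R) : derivable f (y + s *: u) u ->
  is_derive s 1 (fun t => f (y + t *: u)) ('D_u f (y + s *: u)).
Proof.
move=> df; apply: DeriveDef; first by rewrite /derivable line_growth.
by rewrite /derive line_growth.
Qed.

Lemma MVT_line f (y u : 'rV[R]_n) (t : R) : 0 < t ->
  (forall s, 0 <= s <= t -> derivable f (y + s *: u) u) ->
  exists2 s, 0 <= s <= t & f (y + t *: u) - f y = t * 'D_u f (y + s *: u).
Proof.
move=> t0 df.
have [s st E] : exists2 s, s \in `[0, t]%R &
    f (y + t *: u) - f (y + 0 *: u) = 'D_u f (y + s *: u) * (t - 0).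
  apply: (@MVT_segment R (fun s => f (y + s *: u))); first exact: ltW.
    by move=> s /itvP st; apply/is_derive_line/df; rewrite !st.
  apply: derivable_within_continuous => s /itvP st.
  by have [] := is_derive_line (df s _); rewrite ?st.
exists s; first by rewrite !(itvP st).
by move: E; rewrite scale0r addr0 subr0 mulrC.
Qed.

Lemma shift_growth f (w a v : 'rV[R]_n) :
  (fun h : R => h^-1 *: ((fun y => f (y + w)) (h *: v + a) - f (a + w)))
  = (fun h : R => h^-1 *: (f (h *: v + (a + w)) - f (a + w))).
Proof. by apply/funext => h; rewrite addrA. Qed.

Lemma is_derive_translate f (w a v : 'rV[R]_n) : derivable f (a + w) v ->
  is_derive a v (fun y => f (y + w)) ('D_v f (a + w)).
Proof.
move=> df; apply: DeriveDef; first by rewrite /derivable shift_growth.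
by rewrite /derive shift_growth.
Qed.

(** The mean value theorem is used twice: along [u] for y |-> f (y + t v) - f y, then along [v] for
    D_u f. The second difference becomes t^2 times D_v D_u f at a point that tends to [x] with t,
    and continuity of this derivative at [x] concludes. *)
Lemma second_difference U f (x u v : 'rV[R]_n) : open U -> U x ->
  Ck 2 U f -> forall e : R, 0 < e -> \forall t \near 0^'+,
  `|f (x + t *: u + t *: v) - f (x + t *: u) - f (x + t *: v) + f x
    - t ^+ 2 * 'D_v (fun y => 'D_u f y) x| <= t ^+ 2 * e.
Proof.
move=> oU Ux [df C1] e e0; have [dDf C0] := C1 u.
have cD := C0 v x Ux.
have : nbhs x [set z | U z /\ `|'D_v (fun y => 'D_u f y) x
                                - 'D_v (fun y => 'D_u f y) z| < e].
  apply: filterI; first exact: open_nbhs_nbhs.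
  by move/cvgrPdist_lt: cD => /(_ e e0).
move=> /nbhs_ballP[r /= r0 xr].
(* The summand 1 keeps the divisor of [r] positive when [u] and [v] both vanish. *)
have m0 : 0 < `|u| + `|v| + 1 by rewrite ltr_wpDl// addr_ge0.
near=> t.
have t0 : 0 < t by near: t; exact: nbhs_right_gt.
have tr : t * (`|u| + `|v| + 1) < r.
  rewrite -ltr_pdivlMr//; near: t; apply: nbhs_right_lt.
  by rewrite divr_gt0.
have inU a b : 0 <= a <= t -> 0 <= b <= t -> ball x r (x + a *: u + b *: v).
  move=> /andP[a0 at_] /andP[b0 bt]; rewrite -ball_normE /= -addrA opprD addNKr.
  rewrite normrN; apply: le_lt_trans tr; apply: le_trans (ler_normD _ _) _.
  rewrite !normrZ !ger0_norm// mulrDr mulr1 mulrDr -addrA lerD ?ler_wpM2r//.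
  by rewrite (le_trans (ler_wpM2r _ bt))// lerDl ltW.
have tt : 0 <= t <= t by rewrite lexx ltW.
have z0 : 0 <= (0 : R) <= t by rewrite lexx ltW.
have inU0 a : 0 <= a <= t -> ball x r (x + a *: u).
  by move=> /inU/(_ z0); rewrite scale0r addr0.
have dg z : U z -> U (z + t *: v) ->
    is_derive z u (fun y => f (y + t *: v) - f y)
      ('D_u f (z + t *: v) - 'D_u f z).
  move=> Uz Uzt; apply: is_deriveB; last first.
    by apply/derivableP/diff_derivable/df.
  by apply: is_derive_translate; apply/diff_derivable/df.
have [a at_ Ea] : exists2 a, 0 <= a <= t &
    (fun y => f (y + t *: v) - f y) (x + t *: u) - (fun y => f (y + t *: v) - f y) x
    = t * 'D_u (fun y => f (y + t *: v) - f y) (x + a *: u).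
  apply: (MVT_line t0) => s st.
  by have [] := dg _ (xr _ (inU0 _ st)).1 (xr _ (inU _ _ st tt)).1.
have [b bt Eb] := @MVT_line (fun y => 'D_u f y) (x + a *: u) v t t0
  (fun s st => diff_derivable (dDf _ (xr _ (inU _ _ at_ st)).1)).
have [_ dge] := dg _ (xr _ (inU0 _ at_)).1 (xr _ (inU _ _ at_ tt)).1.
rewrite dge Eb in Ea.
move: Ea; rewrite opprB addrA addrAC => ->.
rewrite mulrA -expr2 -mulrBr normrM gtr0_norm ?exprn_gt0//.
rewrite ler_wpM2l ?exprn_ge0 ?(ltW t0)// distrC.
by have [_ /ltW] := xr _ (inU _ _ at_ bt).
Unshelve. all: by end_near. Qed.

(** The second difference is symmetric in the two directions, so for small t its quotient by t^2 is
    within e / 2 of either mixed derivative. *)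
Lemma derive_swap U f (x u v : 'rV[R]_n) : open U -> U x -> Ck 2 U f ->
  'D_u (fun y => 'D_v f y) x = 'D_v (fun y => 'D_u f y) x.
Proof.
move=> oU Ux C2; apply/eqP; rewrite -subr_eq0 -normr_le0; apply/ler_addgt0Pl => e e0.
rewrite addr0.
have e2 : 0 < e / 2 by rewrite divr_gt0.
have [t [[t0 H1] H2]] := filter_ex (filterI (filterI (nbhs_right_gt (0 : R))
  (second_difference u v oU Ux C2 e2)) (second_difference v u oU Ux C2 e2)).
have E : f (x + t *: v + t *: u) = f (x + t *: u + t *: v).
  by congr f; exact: addrAC.
rewrite /= E in H2 => {E}.
have t2 : 0 < t ^+ 2 by rewrite exprn_gt0.
have aux (p q r s a b : R) :
    `|p - q - r + s - t ^+ 2 * a| <= t ^+ 2 * (e / 2) ->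
    `|p - r - q + s - t ^+ 2 * b| <= t ^+ 2 * (e / 2) -> `|b - a| <= e.
  move=> h1 h2; rewrite -(ler_pM2l t2) (splitr e) mulrDr.
  apply: le_trans (lerD h1 h2); rewrite -{1}(gtr0_norm t2) -normrM.
  apply: le_trans (ler_normB _ _); rewrite le_eqVlt; apply/orP; left; apply/eqP.
  by congr (`| _ |); ring.
exact: aux H1 H2.
Qed.

End SymmetricSecondDerivative.


(** * Complex-valued functions and vector fields *)

Section ComplexCalculus.
Context {R : realType} {n : nat}.
Notation C := (R[i]).
Implicit Types (U : set 'rV[R]_n) (f g : 'rV[R]_n -> C).

Lemma eq_csmooth U f g : open U -> {in U, f =1 g} ->
  csmooth_on U f -> csmooth_on U g.
Proof.
move=> oU fg [sR sI]; split=> k;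
  [apply: eq_Ck oU _ (sR k)|apply: eq_Ck oU _ (sI k)] => x Ux; by rewrite fg.
Qed.

Lemma csmooth_cst U (z : C) : csmooth_on U (fun=> z).
Proof. by split=> k; exact: Ck_cst. Qed.

Lemma csmoothD U f g : open U -> csmooth_on U f -> csmooth_on U g ->
  csmooth_on U (fun x => f x + g x).
Proof.
move=> oU [fR fI] [gR gI]; split=> k.
  apply: (eq_Ck oU _ (CkD oU (fR k) (gR k))) => x _; by case: (f x); case: (g x).
apply: (eq_Ck oU _ (CkD oU (fI k) (gI k))) => x _; by case: (f x); case: (g x).
Qed.

Lemma csmoothM U f g : open U -> csmooth_on U f -> csmooth_on U g ->
  csmooth_on U (fun x => f x * g x).
Proof.
move=> oU [fR fI] [gR gI]; split=> k.
  have := CkD oU (CkM oU (fR k) (gR k))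
    (CkM oU (Ck_cst k U (-1)) (CkM oU (fI k) (gI k))).
  apply: eq_Ck => // x _.
  by case: (f x) => a b; case: (g x) => c d /=; rewrite mulN1r.
apply: (eq_Ck oU _ (CkD oU (CkM oU (fR k) (gI k)) (CkM oU (fI k) (gR k)))) => x _.
by case: (f x) => a b; case: (g x) => c d /=.
Qed.

Lemma csmoothN U f : open U -> csmooth_on U f -> csmooth_on U (fun x => - f x).
Proof.
move=> oU sf; apply: (eq_csmooth oU _ (csmoothM oU (csmooth_cst _ (-1)) sf)) => x _.
by rewrite mulN1r.
Qed.

Lemma csmooth_conj U f : open U -> csmooth_on U f ->
  csmooth_on U (fun x => (f x)^*%C).
Proof.
move=> oU [fR fI]; split=> k.
  by apply: (eq_Ck oU _ (fR k)) => x _; case: (f x).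
apply: (eq_Ck oU _ (CkM oU (Ck_cst k U (-1)) (fI k))) => x _.
by case: (f x) => a b /=; rewrite mulN1r.
Qed.

Lemma csmooth_pd U f i : csmooth_on U f -> csmooth_on U (pd i f).
Proof. by case=> fR fI; split; exact: smooth_derive. Qed.

Lemma csmooth_sum U (I : Type) (r : seq I) (F : I -> 'rV[R]_n -> C) : open U ->
  (forall i, csmooth_on U (F i)) -> csmooth_on U (fun x => \sum_(i <- r) F i x).
Proof.
move=> oU sF; elim: r => [|i r IH].
  by apply: (eq_csmooth oU _ (csmooth_cst U 0)) => x _; rewrite big_nil.
by apply: (eq_csmooth oU _ (csmoothD oU (sF i) IH)) => x _; rewrite big_cons.
Qed.

Lemma eq_pd U f g i x : open U -> U x -> {in U, f =1 g} -> pd i f x = pd i g x.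
Proof.
move=> oU Ux fg; have H := open_near oU Ux fg.
by congr Complex; apply: near_eq_derive; apply: filterS H => y ->.
Qed.

Lemma pd_cst (z : C) (i : 'I_n) x : pd i (fun=> z) x = 0.
Proof.
by rewrite /pd (derive_cst (complex.Re z)) (derive_cst (complex.Im z)).
Qed.

Section AtPoint.
Variables (U : set 'rV[R]_n) (f g : 'rV[R]_n -> C) (x : 'rV[R]_n) (i : 'I_n).
Hypotheses (sf : csmooth_on U f) (sg : csmooth_on U g) (Ux : U x).

Let dfR := smooth_derivable (v := delta_mx 0 i) sf.1 Ux.
Let dfI := smooth_derivable (v := delta_mx 0 i) sf.2 Ux.
Let dgR := smooth_derivable (v := delta_mx 0 i) sg.1 Ux.
Let dgI := smooth_derivable (v := delta_mx 0 i) sg.2 Ux.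

Lemma pdD : pd i (fun y => f y + g y) x = pd i f x + pd i g x.
Proof.
rewrite /pd; have -> : (fun y => complex.Re (f y + g y)) =
    (fun y => complex.Re (f y)) + (fun y => complex.Re (g y)).
  by apply/funext => y; rewrite [RHS]/GRing.add /=; case: (f y); case: (g y).
have -> : (fun y => complex.Im (f y + g y)) =
    (fun y => complex.Im (f y)) + (fun y => complex.Im (g y)).
  by apply/funext => y; rewrite [RHS]/GRing.add /=; case: (f y); case: (g y).
by rewrite !deriveD.
Qed.

Lemma pdM : pd i (fun y => f y * g y) x = pd i f x * g x + f x * pd i g x.
Proof.
rewrite /pd; have -> : (fun y => complex.Re (f y * g y)) =
    (fun y => complex.Re (f y)) * (fun y => complex.Re (g y)) -
    (fun y => complex.Im (f y)) * (fun y => complex.Im (g y)).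
  apply/funext => y; rewrite [RHS]/GRing.add /GRing.opp /= /GRing.mul /=.
  by case: (f y); case: (g y).
have -> : (fun y => complex.Im (f y * g y)) =
    (fun y => complex.Re (f y)) * (fun y => complex.Im (g y)) +
    (fun y => complex.Im (f y)) * (fun y => complex.Re (g y)).
  apply/funext => y; rewrite [RHS]/GRing.add /= /GRing.mul /=.
  by case: (f y); case: (g y).
have [_ ->] := is_deriveB (is_deriveM (derivableP dfR) (derivableP dgR))
  (is_deriveM (derivableP dfI) (derivableP dgI)).
have [_ ->] := is_deriveD (is_deriveM (derivableP dfR) (derivableP dgI))
  (is_deriveM (derivableP dfI) (derivableP dgR)).
have aux (a b c d p q r s : R) :
  Complex (a * r + c * p - (b * s + d * q)) (a * s + d * p + (b * r + c * q))
  = Complex p q * Complex c d + Complex a b * Complex r s.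
  by apply/eqP; rewrite eq_complex /=; apply/andP; split; apply/eqP; ring.
by case: (f x) => a b; case: (g x) => c d; exact: aux.
Qed.

Lemma pd_conj : pd i (fun y => (f y)^*%C) x = (pd i f x)^*%C.
Proof.
rewrite /pd /=; have -> : (fun y => complex.Im (f y)^*%C) =
    - (fun y => complex.Im (f y)).
  by apply/funext => y; rewrite [RHS]/GRing.opp /=; case: (f y).
have -> : (fun y => complex.Re (f y)^*%C) = (fun y => complex.Re (f y)).
  by apply/funext => y; case: (f y).
by rewrite deriveN.
Qed.

Lemma pd_comm j : open U -> pd i (pd j f) x = pd j (pd i f) x.
Proof.
move=> oU; rewrite /pd /=.
have -> := derive_swap (delta_mx 0 i) (delta_mx 0 j) oU Ux (sf.1 2).
by have -> := derive_swap (delta_mx 0 i) (delta_mx 0 j) oU Ux (sf.2 2).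
Qed.

End AtPoint.

Definition vsmooth_on U (X : vfield n) :=
  forall j, csmooth_on U (fun x => X x 0 j).

Section App.
Variables (U : set 'rV[R]_n) (oU : open U).
Implicit Types (X Y Z : @vfield R n) (x : 'rV[R]_n).

Lemma csmooth_app X f : vsmooth_on U X -> csmooth_on U f -> csmooth_on U (app X f).
Proof.
move=> sX sf; apply: csmooth_sum => // j.
by apply: csmoothM => //; exact: csmooth_pd.
Qed.

Lemma eq_app X f g x : U x -> {in U, f =1 g} -> app X f x = app X g x.
Proof. by move=> Ux fg; apply: eq_bigr => j _; rewrite (eq_pd _ oU Ux fg). Qed.

Lemma app_cst X (z : C) x : app X (fun=> z) x = 0.
Proof. by rewrite /app big1 // => j _; rewrite pd_cst mulr0. Qed.

Lemma appD X f g x : csmooth_on U f -> csmooth_on U g -> U x ->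
  app X (fun y => f y + g y) x = app X f x + app X g x.
Proof.
move=> sf sg Ux; rewrite /app -big_split; apply: eq_bigr => j _.
by rewrite (pdD _ sf sg Ux) mulrDr.
Qed.

Lemma appM X f g x : csmooth_on U f -> csmooth_on U g -> U x ->
  app X (fun y => f y * g y) x = app X f x * g x + f x * app X g x.
Proof.
move=> sf sg Ux; rewrite /app mulr_suml mulr_sumr -big_split.
apply: eq_bigr => j _.
by rewrite (pdM _ sf sg Ux) mulrDr mulrA mulrCA.
Qed.

Lemma appN X f x : csmooth_on U f -> U x ->
  app X (fun y => - f y) x = - app X f x.
Proof.
move=> sf Ux; rewrite -mulN1r -[RHS]add0r -{1}[0 in RHS](mul0r (f x)).
rewrite -(app_cst X (-1) x) -(appM _ (csmooth_cst U (-1)) sf Ux).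
by apply: eq_app Ux _ => y _; rewrite mulN1r.
Qed.

Lemma app_conj X f x : csmooth_on U f -> U x ->
  app (conjv X) (fun y => (f y)^*%C) x = (app X f x)^*%C.
Proof.
move=> sf Ux; rewrite /app rmorph_sum; apply: eq_bigr => j _.
by rewrite (pd_conj _ sf Ux) mxE rmorphM.
Qed.

Lemma app_addl X Y f x : app (fun y => X y + Y y) f x = app X f x + app Y f x.
Proof.
by rewrite /app -big_split; apply: eq_bigr => j _; rewrite mxE mulrDl.
Qed.

Lemma app_scalel h X f x : app (fun y => h y *: X y) f x = h x * app X f x.
Proof. by rewrite /app mulr_sumr; apply: eq_bigr => j _; rewrite mxE mulrA. Qed.

End App.
End ComplexCalculus.


(** * Lie brackets of complex vector fields *)

Section Bracket.
Context {R : realType} {n : nat}.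
Notation C := (R[i]).
Variables (U : set 'rV[R]_n) (oU : open U).
Implicit Types (X Y Z : @vfield R n) (f h : 'rV[R]_n -> C) (x : 'rV[R]_n).

Lemma app_sum X (I : Type) (r : seq I) (F : I -> 'rV[R]_n -> C) x :
  (forall i, csmooth_on U (F i)) -> U x ->
  app X (fun y => \sum_(i <- r) F i y) x = \sum_(i <- r) app X (F i) x.
Proof.
move=> sF Ux; elim: r => [|i r IH].
  rewrite big_nil -[RHS](app_cst X 0 x); apply: (eq_app oU) => // y _.
  by rewrite big_nil.
rewrite big_cons -IH -(appD (U := U)) //; last exact: csmooth_sum.
by apply: (eq_app oU) => // y _; rewrite big_cons.
Qed.

(** The terms with second derivatives of [f] cancel by [pd_comm]; what remains is the coefficient
    formula that defines [bracket]. *)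
Lemma app_bracket X Y f x : vsmooth_on U X -> vsmooth_on U Y ->
  csmooth_on U f -> U x ->
  app (bracket X Y) f x = app X (app Y f) x - app Y (app X f) x.
Proof.
have second Z W : vsmooth_on U W -> csmooth_on U f -> U x ->
    app Z (app W f) x = \sum_j app Z (fun y => W y 0 j) x * pd j f x +
      \sum_j \sum_i W x 0 j * Z x 0 i * pd i (pd j f) x.
  move=> sW sf Ux; rewrite [LHS]app_sum //; last first.
    by move=> j; apply: csmoothM => //; exact: csmooth_pd.
  rewrite -big_split; apply: eq_bigr => j _.
  rewrite (appM _ (sW j) (csmooth_pd j sf) Ux); congr (_ + _).
  by rewrite /app mulr_sumr; apply: eq_bigr => i _; rewrite mulrA.
move=> sX sY sf Ux; rewrite !second //.
rewrite [X in _ - (_ + X)](_ : _ = \sum_j \sum_i Y x 0 j * X x 0 i * pd i (pd j f) x).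
  rewrite opprD addrACA subrr addr0 -sumrB.
  by apply: eq_bigr => j _; rewrite mxE mulrBl.
rewrite exchange_big; apply: eq_bigr => j _; apply: eq_bigr => i _.
by rewrite [X x 0 i * _]mulrC (pd_comm _ sf Ux).
Qed.

Lemma vsmooth_bracket X Y : vsmooth_on U X -> vsmooth_on U Y ->
  vsmooth_on U (bracket X Y).
Proof.
move=> sX sY j; have s1 := csmooth_app oU sX (sY j).
have s2 := csmooth_app oU sY (sX j).
by apply: (eq_csmooth oU _ (csmoothD oU s1 (csmoothN oU s2))) => x _; rewrite mxE.
Qed.

Lemma vsmooth_conj X : vsmooth_on U X -> vsmooth_on U (conjv X).
Proof.
move=> sX j; apply: (eq_csmooth oU _ (csmooth_conj oU (sX j))) => x _.
by rewrite mxE.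
Qed.

Lemma vsmoothZ f X : csmooth_on U f -> vsmooth_on U X ->
  vsmooth_on U (fun x => f x *: X x).
Proof.
move=> sf sX j; apply: (eq_csmooth oU _ (csmoothM oU sf (sX j))) => x _.
by rewrite mxE.
Qed.

Lemma vsmoothD X Y : vsmooth_on U X -> vsmooth_on U Y ->
  vsmooth_on U (fun x => X x + Y x).
Proof.
move=> sX sY j; apply: (eq_csmooth oU _ (csmoothD oU (sX j) (sY j))) => x _.
by rewrite mxE.
Qed.

Lemma bracketC X Y x : bracket X Y x = - bracket Y X x.
Proof. by apply/rowP => j; rewrite !mxE opprB. Qed.

Lemma bracket_same X x : bracket X X x = 0.
Proof. by apply/rowP => j; rewrite !mxE subrr. Qed.

Lemma eq_bracketr X Y Z x : U x -> {in U, Y =1 Z} -> bracket X Y x = bracket X Z x.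
Proof.
move=> Ux YZ; apply/rowP => j; rewrite !mxE; congr (_ - _).
  by apply: (eq_app oU) => // y Uy; rewrite YZ.
by rewrite /app; apply: eq_bigr => k _; rewrite YZ ?inE.
Qed.

Lemma bracketDr X Y Z x : vsmooth_on U Y -> vsmooth_on U Z -> U x ->
  bracket X (fun y => Y y + Z y) x = bracket X Y x + bracket X Z x.
Proof.
move=> sY sZ Ux; apply/rowP => j; rewrite !mxE app_addl opprD addrACA.
rewrite -(appD _ (sY j) (sZ j) Ux); congr (_ + _).
by apply: (eq_app oU) => // y _; rewrite mxE.
Qed.

Lemma bracketZr X Y h x : vsmooth_on U Y -> csmooth_on U h -> U x ->
  bracket X (fun y => h y *: Y y) x = h x *: bracket X Y x + app X h x *: Y x.
Proof.
move=> sY sh Ux; apply/rowP => j; rewrite !mxE app_scalel.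
have -> : app X (fun y => (h y *: Y y) 0 j) x = app X (fun y => h y * Y y 0 j) x.
  by apply: (eq_app oU) => // y _; rewrite mxE.
by rewrite (appM _ sh (sY j) Ux); ring.
Qed.

Lemma bracket_conj X Y x : vsmooth_on U X -> vsmooth_on U Y -> U x ->
  bracket (conjv X) (conjv Y) x = conjmx (bracket X Y x).
Proof.
move=> sX sY Ux; apply/rowP => j; rewrite !mxE rmorphB /=.
rewrite -(app_conj _ (sX j) Ux) -(app_conj _ (sY j) Ux).
by congr (_ - _); apply: (eq_app oU) => // y _; rewrite mxE.
Qed.

(** By [app_bracket], each j-th component is a combination of iterated derivatives of the j-th
    coefficients of the three fields, such as X(Y(Z_j)), and these cancel in pairs. *)
Lemma jacobi X Y Z x :
  vsmooth_on U X -> vsmooth_on U Y -> vsmooth_on U Z -> U x ->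
  bracket X (bracket Y Z) x =
  bracket (bracket X Y) Z x + bracket Y (bracket X Z) x.
Proof.
have second A B D j : vsmooth_on U B -> vsmooth_on U D -> U x ->
    app A (fun y => bracket B D y 0 j) x =
    app A (app B (fun y => D y 0 j)) x - app A (app D (fun y => B y 0 j)) x.
  move=> sB sD Ux; have s1 := csmooth_app oU sB (sD j).
  have s2 := csmooth_app oU sD (sB j).
  rewrite -(appN oU _ s2 Ux) -(appD _ s1 (csmoothN oU s2) Ux).
  by apply: (eq_app oU) => // y _; rewrite mxE.
move=> sX sY sZ Ux; apply/rowP => j; rewrite [RHS]mxE.
have E A B : bracket A B x 0 j =
    app A (fun y => B y 0 j) x - app B (fun y => A y 0 j) x by rewrite mxE.
have H1 := congr2 (fun a b : C => a - b)
  (second X Y Z j sY sZ Ux) (app_bracket sY sZ (sX j) Ux).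
have H2 := congr2 (fun a b : C => a - b)
  (app_bracket sX sY (sZ j) Ux) (second Z X Y j sX sY Ux).
have H3 := congr2 (fun a b : C => a - b)
  (second Y X Z j sX sZ Ux) (app_bracket sX sZ (sY j) Ux).
apply: etrans (etrans (E X _) H1) _.
apply: etrans (esym (congr2 +%R (etrans (E _ Z) H2) (etrans (E Y _) H3))).
cbv beta; move: (app X _ x) (app X _ x) (app Y _ x) (app Y _ x) => *.
by move: (app Z _ x) (app Z _ x) => *; ring.
Qed.

End Bracket.


(** * Conjugation of the structure functions *)

Section StructureFunctions.
Context {R : realType}.
Notation C := (R[i]).
Variables (U : set 'rV[R]_5) (d : @local_data R).
Hypothesis oU : open U.
Local Notation v := (vL d).
Local Notation L f := (app v f).
Local Notation Lb f := (app (conjv v) f).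
Local Notation A := (fA d).
Local Notation B := (fB d).
Local Notation E := (fE d).
Local Notation F := (fF d).
Local Notation G := (fG d).
Local Notation H := (fH d).
Local Notation J := (fJ d).
Local Notation K := (fK d).
Local Notation s := (sqB d).
Local Notation T := (vT v).
Local Notation S := (vS v).
Local Notation Rv := (vR v).
Hypothesis sv : vsmooth_on U v.
Hypotheses (sA : csmooth_on U A) (sB : csmooth_on U B) (sG : csmooth_on U G)
  (sK : csmooth_on U K) (ss : csmooth_on U s).
Hypothesis struct : forall x, U x -> structure_equations d x.
Hypothesis frame_unit : forall x, U x -> frame v x \in unitmx.

Lemma conj_i : ('i%C : C)^*%C = - 'i%C.
Proof. by apply/eqP; rewrite eq_complex /= oppr0 !eqxx. Qed.

Lemma conjmxK m n (M : 'M[C]_(m, n)) : conjmx (conjmx M) = M.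
Proof. by apply/matrixP => i j; rewrite !mxE conjcK. Qed.

Lemma conjmxM m n p (M : 'M[C]_(m, n)) (N : 'M[C]_(n, p)) :
  conjmx (M *m N) = conjmx M *m conjmx N.
Proof. exact: map_mxM. Qed.

Lemma conjmxZ m n (a : C) (M : 'M[C]_(m, n)) : conjmx (a *: M) = a^*%C *: conjmx M.
Proof. exact: map_mxZ. Qed.

Lemma conjmxD m n (M N : 'M[C]_(m, n)) : conjmx (M + N) = conjmx M + conjmx N.
Proof. exact: map_mxD. Qed.

Lemma conjvK (n : nat) (X : @vfield R n) : conjv (conjv X) = X.
Proof. by apply/funext => x; exact: conjmxK. Qed.

Let svb : vsmooth_on U (conjv v). Proof. exact: vsmooth_conj. Qed.

Let sT : vsmooth_on U T.
Proof.
by apply: vsmoothZ => //; [exact: csmooth_cst|exact: vsmooth_bracket].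
Qed.

Let sS : vsmooth_on U S. Proof. exact: vsmooth_bracket. Qed.

Let sR : vsmooth_on U Rv. Proof. exact: vsmooth_bracket. Qed.

Lemma conj_T x : U x -> conjv T x = T x.
Proof.
move=> Ux; rewrite /conjv /vT conjmxZ -(bracket_conj oU sv svb Ux) conjvK.
by rewrite bracketC scalerN conj_i scaleNr opprK.
Qed.

Lemma bracket_Lb_T x : U x -> bracket (conjv v) T x = A x *: T x + B x *: S x.
Proof.
move=> Ux; have [_ <- _ _ _] := struct Ux.
rewrite -[RHS](bracket_conj oU sv sT Ux); apply: (eq_bracketr oU) => // y.
by rewrite inE => Uy; rewrite conj_T.
Qed.

Lemma bracket_Lb_L x : bracket (conjv v) v x = 'i%C *: T x.
Proof. by rewrite /vT scalerA -expr2 sqr_i scaleN1r bracketC. Qed.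

Let bracket_combo X x : vsmooth_on U X -> U x ->
  bracket X (fun y => A y *: T y + B y *: S y) x =
  A x *: bracket X T x + app X A x *: T x
  + (B x *: bracket X S x + app X B x *: S x).
Proof.
move=> sX Ux; rewrite (bracketDr oU _ (vsmoothZ oU sA sT) (vsmoothZ oU sB sS) Ux).
by rewrite (bracketZr oU _ sT sA Ux) (bracketZr oU _ sS sB Ux).
Qed.

(** In the Jacobi identity for Lbar, L, T the term [[Lbar, L], T] = [iT, T] vanishes, which leaves
    [L, [Lbar, T]] = [L, A T + B S]. *)
Lemma bracket_Lb_S x : U x ->
  bracket (conjv v) S x = L A x *: T x + (A x + L B x) *: S x + B x *: Rv x.
Proof.
move=> Ux; rewrite {1}/vS (jacobi oU svb sv sT Ux).
have -> : bracket (bracket (conjv v) v) T x = 0.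
  rewrite bracketC.
  have -> : bracket T (bracket (conjv v) v) x = bracket T (fun y => 'i%C *: T y) x.
    by apply: (eq_bracketr oU) => // y _; exact: bracket_Lb_L.
  rewrite (bracketZr oU _ sT (csmooth_cst _ _) Ux) bracket_same app_cst.
  by rewrite scaler0 scale0r addr0 oppr0.
have -> : bracket v (bracket (conjv v) T) x =
    bracket v (fun y => A y *: T y + B y *: S y) x.
  by apply: (eq_bracketr oU) => // y; rewrite inE; exact: bracket_Lb_T.
rewrite add0r bracket_combo // -/(vS v) -/(vR v) scalerDl.
by rewrite [A x *: _ + _]addrC -!addrA; congr (_ + (_ + _)); exact: addrC.
Qed.

(** [rS] and [rT] are the S- and T-components of conj(R), read off from [Lbar, A T + B S]. *)
Definition rS : 'rV[R]_5 -> C := fun x => 2 * (A x * B x) + Lb B x + B x * L B x.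
Definition rT : 'rV[R]_5 -> C := fun x => Lb A x + A x ^+ 2 + B x * L A x.

Lemma conj_R x : U x ->
  conjv Rv x = B x ^+ 2 *: Rv x + rS x *: S x + rT x *: T x.
Proof.
move=> Ux; rewrite {1}/conjv {1}/vR -(bracket_conj oU sv sS Ux).
have -> : bracket (conjv v) (conjv S) x =
    bracket (conjv v) (fun y => A y *: T y + B y *: S y) x.
  by apply: (eq_bracketr oU) => // y; rewrite inE => Uy; have [_ -> _ _ _] := struct Uy.
rewrite bracket_combo // bracket_Lb_T // bracket_Lb_S //.
rewrite /rS /rT.
move: (T x) (S x) (Rv x) (L A x) (Lb A x) (L B x) (Lb B x) => t u w *.
by apply/rowP => j; rewrite !mxE; ring.
Qed.

Lemma frame_coef x (a b c a' b' c' : C) : U x ->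
  a *: Rv x + b *: S x + c *: T x = a' *: Rv x + b' *: S x + c' *: T x ->
  [/\ a = a', b = b' & c = c'].
Proof.
move=> Ux; have comb (p q r : C) : p *: Rv x + q *: S x + r *: T x =
    (\row_(i < 5) [:: p; q; r; 0; 0]`_i) *m frame v x.
  rewrite mulmx_sum_row !big_ord_recl big_ord0 !mxE /= !rowK /=.
  by rewrite !scale0r !addr0 !addrA.
rewrite !comb => /(can_inj (mulmxK (frame_unit Ux))) /rowP E5.
have := (E5 0, E5 1, E5 2%:R); rewrite !mxE /=.
by case; case.
Qed.


(** Conjugating conj(S) = A T + B S a second time gives S back; the S- and T-components of the
    outcome are the two relations. *)
Lemma conj_AB x : U x -> B x * (B x)^*%C = 1 /\ (A x)^*%C = - (A x * (B x)^*%C).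
Proof.
move=> Ux; have [_ ES _ _ _] := struct Ux.
have := congr1 conjmx ES; rewrite {1}/conjv conjmxK conjmxD (conjmxZ (A x)) (conjmxZ (B x)).
have cT : conjmx (T x) = T x := conj_T Ux.
have cS : conjmx (S x) = A x *: T x + B x *: S x := ES.
rewrite cT cS => {}ES.
have : 0 *: Rv x + 1 *: S x + 0 *: T x = 0 *: Rv x + (B x)^*%C * B x *: S x
    + ((A x)^*%C + (B x)^*%C * A x) *: T x.
  rewrite !scale0r scale1r !add0r addr0 [LHS]ES.
  move: (S x) (T x) => u t.
  by apply/rowP => j; rewrite !mxE; ring.
case/(frame_coef Ux) => _ EB EA; split; first by rewrite mulrC.
by apply/eqP; rewrite -addr_eq0 [A x * _]mulrC -EA.
Qed.

Lemma conj_s x : U x -> s x * (s x)^*%C = 1.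
Proof.
move=> Ux; have [EB _] := conj_AB Ux; have [_ _ _ _ Es] := struct Ux.
move: EB; rewrite -Es rmorphXn -exprMn; case: (s x) => a b /eqP.
rewrite eq_complex /= => /andP[/eqP Ea _].
apply/eqP; rewrite eq_complex /=; apply/andP; split; last by apply/eqP; ring.
(* The square of s conj(s) is B conj(B) = 1, and s conj(s), a sum of two squares, is the nonnegative
   root. *)
rewrite -(sqrp_eq1 (x := a * a - b * - b)); first by rewrite -Ea; apply/eqP; ring.
by rewrite mulrN opprK -!expr2 addr_ge0 ?sqr_ge0.
Qed.

Lemma s_neq0 x : U x -> s x != 0.
Proof.
by move=> Ux; apply/eqP => s0; move/eqP: (conj_s Ux); rewrite s0 mul0r eq_sym oner_eq0.
Qed.

Lemma conj_sV x : U x -> (s x)^*%C = (s x)^-1.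
Proof. by move=> Ux; rewrite -[LHS](mulKf (s_neq0 Ux)) conj_s // mulr1. Qed.

Lemma sq_s x : U x -> B x = s x ^+ 2.
Proof. by move=> Ux; have [_ _ _ _ ->] := struct Ux. Qed.

Lemma conj_BV x : U x -> (B x)^*%C = (s x ^+ 2)^-1.
Proof. by move=> Ux; rewrite sq_s // rmorphXn /= conj_sV // exprVn. Qed.

Lemma conj_A x : U x -> (A x)^*%C = - (A x / s x ^+ 2).
Proof. by move=> Ux; have [_ ->] := conj_AB Ux; rewrite conj_BV. Qed.

Lemma smooth_rS : csmooth_on U rS.
Proof.
apply: csmoothD => //; last by apply: csmoothM => //; exact: csmooth_app.
apply: csmoothD => //; last exact: csmooth_app.
by apply: csmoothM; [|exact: csmooth_cst|exact: csmoothM].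
Qed.

Lemma smooth_rT : csmooth_on U rT.
Proof.
apply: csmoothD => //; last by apply: csmoothM => //; exact: csmooth_app.
by apply: csmoothD; [|exact: csmooth_app|exact: csmoothM].
Qed.

Lemma bracket_conj_R X x : vsmooth_on U X -> U x ->
  bracket X (conjv Rv) x =
  B x ^+ 2 *: bracket X Rv x + (2 * B x * app X B x) *: Rv x
  + (rS x *: bracket X S x + app X rS x *: S x)
  + (rT x *: bracket X T x + app X rT x *: T x).
Proof.
move=> sX Ux; have -> : bracket X (conjv Rv) x =
    bracket X (fun y => B y ^+ 2 *: Rv y + rS y *: S y + rT y *: T y) x.
  by apply: (eq_bracketr oU) => // y; rewrite inE; exact: conj_R.
have sB2 : csmooth_on U (fun y => B y ^+ 2) by exact: csmoothM.
have s1 := vsmoothZ oU sB2 sR; have s2 := vsmoothZ oU smooth_rS sS.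
have s3 := vsmoothZ oU smooth_rT sT.
rewrite (bracketDr oU _ (vsmoothD oU s1 s2) s3 Ux) (bracketDr oU _ s1 s2 Ux).
rewrite (bracketZr oU _ sR sB2 Ux) (bracketZr oU _ sS smooth_rS Ux).
rewrite (bracketZr oU _ sT smooth_rT Ux).
suff -> : app X (fun y => B y ^+ 2) x = 2 * B x * app X B x by [].
by apply: etrans (appM X sB sB Ux) _; ring.
Qed.

(** These are the R- and S-components of conj([L, R]) = [Lbar, conj(R)], whose right side is
    expanded with the formula for conj(R). *)
Lemma conj_FG x : U x ->
  (G x)^*%C * B x ^+ 2 = 2 * B x * Lb B x + B x ^+ 2 * K x + rS x * B x /\
  (F x)^*%C * B x + (G x)^*%C * rS x =
  B x ^+ 2 * J x + Lb rS x + rS x * (A x + L B x) + rT x * B x.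
Proof.
move=> Ux; have [_ ES EL EK _] := struct Ux.
have := bracket_conj oU sv sR Ux; rewrite bracket_conj_R // EK EL.
rewrite bracket_Lb_S // bracket_Lb_T // !conjmxD (conjmxZ (E x)) (conjmxZ (F x)) (conjmxZ (G x)).
have cT : conjmx (T x) = T x := conj_T Ux.
have cS : conjmx (S x) = A x *: T x + B x *: S x := ES.
have cR : conjmx (Rv x) = _ := conj_R Ux.
rewrite cT cS cR.
have := @frame_coef x _ _ _ _ _ _ Ux.
move: (T x) (S x) (Rv x) (L B x) (Lb B x) (Lb rS x) (Lb rT x) (L A x) => t u w lb lbb lbs lbt la.
move: (B x) (A x) (rS x) (rT x) => b a p q.
move: (E x)^*%C (F x)^*%C (G x)^*%C => e f g.
move=> coef EE; have [EG EF _] : [/\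
  2 * b * lbb + b ^+ 2 * K x + p * b = g * b ^+ 2,
  b ^+ 2 * J x + lbs + p * (a + lb) + q * b = f * b + g * p &
  b ^+ 2 * H x + p * la + q * a + lbt = e + f * a + g * q].
  apply: coef; move/rowP: EE => EE; apply/rowP => j; move: (EE j); rewrite !mxE.
  move=> {}EE; apply/eqP; rewrite -subr_eq0; move/eqP: EE; rewrite -subr_eq0.
  by move=> /eqP EE; apply/eqP; rewrite -[RHS]EE; ring.
by [].
Qed.


(** The companion of [conj_FG], from conj([Lbar, R]) = [L, conj(R)]. *)
Lemma conj_JK x : U x ->
  (K x)^*%C * B x ^+ 2 = 2 * B x * L B x + B x ^+ 2 * G x + rS x /\
  (J x)^*%C * B x + (K x)^*%C * rS x = B x ^+ 2 * F x + L rS x + rT x.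
Proof.
move=> Ux; have [_ ES EL EK _] := struct Ux.
have := bracket_conj oU svb sR Ux; rewrite conjvK bracket_conj_R // EK EL.
rewrite !conjmxD (conjmxZ (H x)) (conjmxZ (J x)) (conjmxZ (K x)).
rewrite -/(vS v) -/(vR v) -/(vS v).
have cT : conjmx (T x) = T x := conj_T Ux.
have cS : conjmx (S x) = A x *: T x + B x *: S x := ES.
have cR : conjmx (Rv x) = _ := conj_R Ux.
rewrite cT cS cR.
have := @frame_coef x _ _ _ _ _ _ Ux.
move: (T x) (S x) (Rv x) (L B x) (L rS x) (L rT x) => t u w lb ls lt.
move: (B x) (A x) (rS x) (rT x) => b a p q.
move: (H x)^*%C (J x)^*%C (K x)^*%C => h j k.
move=> coef EE; have [EK' EJ _] : [/\
  2 * b * lb + b ^+ 2 * G x + p = k * b ^+ 2,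
  b ^+ 2 * F x + ls + q = j * b + k * p &
  b ^+ 2 * E x + lt = h + j * a + k * q].
  apply: coef; move/rowP: EE => EE; apply/rowP => l; move: (EE l); rewrite !mxE.
  move=> {}EE; apply/eqP; rewrite -subr_eq0; move/eqP: EE; rewrite -subr_eq0.
  by move=> /eqP EE; apply/eqP; rewrite -[RHS]EE; ring.
by [].
Qed.

Lemma app_B X x : U x -> app X B x = 2 * s x * app X s x.
Proof.
move=> Ux; rewrite (eq_app oU (g := fun y => s y * s y) X Ux); last first.
  by move=> y; rewrite inE => Uy; rewrite sq_s.
by rewrite (appM X ss ss Ux); ring.
Qed.

Lemma app_conj_s X x : U x ->
  app X (fun y => (s y)^*%C) x = - (app X s x / s x ^+ 2).
Proof.
move=> Ux; have s0 := s_neq0 Ux; have scs := csmooth_conj oU ss.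
have := appM X ss scs Ux; rewrite (eq_app oU (g := fun=> 1) X Ux); last first.
  by move=> y; rewrite inE; exact: conj_s.
rewrite app_cst conj_sV // => /esym/eqP; rewrite addrC addr_eq0 => /eqP EE.
by apply: (mulfI s0); rewrite EE; field.
Qed.

Lemma app_conj_B X x : U x ->
  app X (fun y => (B y)^*%C) x = - (app X B x / s x ^+ 4).
Proof.
move=> Ux; have s0 := s_neq0 Ux; have scs := csmooth_conj oU ss.
rewrite (eq_app oU (g := fun y => (s y)^*%C * (s y)^*%C) X Ux); last first.
  by move=> y; rewrite inE => Uy; rewrite sq_s // rmorphXn.
rewrite (appM X scs scs Ux) app_conj_s // app_B // conj_sV //; field.
exact: s0.
Qed.

Lemma conj_LB x : U x -> (L B x)^*%C = - (Lb B x / s x ^+ 4).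
Proof. by move=> Ux; rewrite -(app_conj _ sB Ux) app_conj_B. Qed.

Lemma conj_LbB x : U x -> (Lb B x)^*%C = - (L B x / s x ^+ 4).
Proof. by move=> Ux; rewrite -(app_conj _ sB Ux) conjvK app_conj_B. Qed.

Lemma conj_G x : U x -> (G x)^*%C =
  2 * Lb B x / s x ^+ 2 + K x + rS x / s x ^+ 2.
Proof.
move=> Ux; have s0 := s_neq0 Ux; have [EG _] := conj_FG Ux.
have b0 : B x ^+ 2 != 0 by rewrite sq_s // !expf_neq0.
apply: (mulIf b0); rewrite EG sq_s //; field.
exact: s0.
Qed.

Lemma conj_K x : U x -> (K x)^*%C =
  2 * L B x / s x ^+ 2 + G x + rS x / s x ^+ 4.
Proof.
move=> Ux; have s0 := s_neq0 Ux; have [EK _] := conj_JK Ux.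
have b0 : B x ^+ 2 != 0 by rewrite sq_s // !expf_neq0.
apply: (mulIf b0); rewrite EK sq_s //; field.
exact: s0.
Qed.

Let conjD (z w : C) : (z + w)^*%C = z^*%C + w^*%C. Proof. exact: rmorphD. Qed.
Let conjN (z : C) : (- z)^*%C = - z^*%C. Proof. exact: rmorphN. Qed.
Let conjM (z w : C) : (z * w)^*%C = z^*%C * w^*%C. Proof. exact: rmorphM. Qed.
Let conjX (z : C) n : (z ^+ n)^*%C = z^*%C ^+ n. Proof. exact: rmorphXn. Qed.

Let conj_simp := (conjD, conjN, conjM, conjX, @conjc_inv R, @conjc_nat R, @conjc1 R).

(** The increment is forced by the reality of sigma_4: its value on conj(R) is B F_0 + r_S / s, and
    this must be the conjugate F_0^* B of its value F_0 / B on R. The increments of C_0 and G_0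
    below come in the same way from rho_4 on conj(S) and conj(R). *)
Lemma conj_F0 x : U x -> (aF0 d x)^*%C = aF0 d x + rS x / s x ^+ 3.
Proof.
move=> Ux; have s0 := s_neq0 Ux; rewrite /aF0 !conj_simp.
rewrite conj_LB // conj_LbB // conj_G // conj_K // conj_A // conj_BV // conj_sV //.
rewrite /rS sq_s //; move: (L B x) (Lb B x) => lb lbb; field.
exact: s0.
Qed.

Lemma conj_C0 x : U x -> (aC0 d x)^*%C = aC0 d x + A x / s x.
Proof.
move=> Ux; have s0 := s_neq0 Ux; rewrite /aC0 !conj_simp.
rewrite conj_LB // conj_LbB // conj_G // conj_K // conj_A // conj_BV // conj_sV //.
rewrite /rS sq_s //; move: (L B x) (Lb B x) => lb lbb; field.
exact: s0.
Qed.

(** This makes the two terms of feature (i) that contain I_1 conjugate to each other. *)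
Lemma conj_I1 x : U x -> (I1 d x)^*%C = - I1 d x.
Proof.
move=> Ux; have s0 := s_neq0 Ux; rewrite /I1 !conj_simp.
rewrite conj_LB // conj_LbB // conj_G // conj_K // conj_A // conj_BV // conj_sV //.
rewrite /rS sq_s //; move: (L B x) (Lb B x) => lb lbb; field.
exact: s0.
Qed.


(** On [U] a quotient by s or B is a product with conj(s) or conj(B), so sums and products of smooth
    functions suffice. *)
Lemma smooth_F0 : csmooth_on U (aF0 d).
Proof.
have scs := csmooth_conj oU ss; have scB := csmooth_conj oU sB.
have sLB := csmooth_app oU sv sB; have sLbB := csmooth_app oU svb sB.
have sC (a : C) f : csmooth_on U f -> csmooth_on U (fun x => a * f x).
  by move=> sf; apply: csmoothM => //; exact: csmooth_cst.
have := csmoothD oU (csmoothD oU (csmoothD oU (csmoothD oU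
  (sC (1 / 10) _ (csmoothM oU sLB scs))
  (sC (3 / 10) _ (csmoothM oU ss sG)))
  (sC (1 / 10) _ (csmoothM oU sLbB (csmoothM oU scB scs))))
  (sC (- (2 / 5)) _ (csmoothM oU sA scs)))
  (sC (3 / 10) _ (csmoothM oU sK scs)).
apply: (eq_csmooth oU) => x; rewrite inE => Ux; have s0 := s_neq0 Ux.
rewrite conj_sV // conj_BV // /aF0 sq_s //.
by move: (L B x) (Lb B x) => lb lbb; field.
Qed.

(** The difference conj(F_0) - F_0, named as a function because G_0 requires its derivatives. *)
Let q x := rS x / s x ^+ 3.

Let qE : {in U, (fun y => rS y * ((s y)^*%C * ((s y)^*%C * (s y)^*%C))) =1 q}.
Proof.
move=> y; rewrite inE => Uy; have s0 := s_neq0 Uy.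
by rewrite conj_sV // /q; field.
Qed.

Let smooth_q : csmooth_on U q.
Proof.
have scs := csmooth_conj oU ss.
exact: eq_csmooth oU qE (csmoothM oU smooth_rS (csmoothM oU scs (csmoothM oU scs scs))).
Qed.

Let app_q X x : U x -> app X q x =
  app X rS x / s x ^+ 3 - 3 / 2 * (rS x * app X B x) / s x ^+ 5.
Proof.
move=> Ux; have s0 := s_neq0 Ux; have scs := csmooth_conj oU ss.
rewrite -(eq_app oU X Ux qE) (appM X smooth_rS (csmoothM oU scs (csmoothM oU scs scs)) Ux).
rewrite (appM X scs (csmoothM oU scs scs) Ux) (appM X scs scs Ux).
rewrite app_conj_s // conj_sV // app_B //.
by move: (app X rS x) (app X s x) => u w; field.
Qed.

Lemma conj_L_F0 x : U x -> (L (aF0 d) x)^*%C = Lb (aF0 d) x + Lb q x.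
Proof.
move=> Ux; rewrite -(app_conj _ smooth_F0 Ux) -(appD _ smooth_F0 smooth_q Ux).
by apply: (eq_app oU) => // y; rewrite inE; exact: conj_F0.
Qed.

Lemma conj_Lb_F0 x : U x -> (Lb (aF0 d) x)^*%C = L (aF0 d) x + L q x.
Proof.
move=> Ux; rewrite -(app_conj _ smooth_F0 Ux) conjvK -(appD _ smooth_F0 smooth_q Ux).
by apply: (eq_app oU) => // y; rewrite inE; exact: conj_F0.
Qed.

Lemma conj_F x : U x -> (F x)^*%C =
  (B x ^+ 2 * J x + Lb rS x + rS x * (A x + L B x) + rT x * B x
   - (G x)^*%C * rS x) / s x ^+ 2.
Proof.
move=> Ux; have s0 := s_neq0 Ux; have [_ <-] := conj_FG Ux.
by rewrite addrK sq_s // mulfK ?expf_neq0.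
Qed.

Lemma conj_J x : U x -> (J x)^*%C =
  (B x ^+ 2 * F x + L rS x + rT x - (K x)^*%C * rS x) / s x ^+ 2.
Proof.
move=> Ux; have s0 := s_neq0 Ux; have [_ <-] := conj_JK Ux.
by rewrite addrK sq_s // mulfK ?expf_neq0.
Qed.

(** The derivatives of r_S brought in by conj(F) and conj(J) cancel those coming from conj(L F_0)
    and conj(Lbar F_0); the r_T term collects one half from each of conj(F) and conj(J). *)
Lemma conj_G0 x : U x -> (aG0 d x)^*%C =
  aG0 d x + rS x / s x ^+ 3 * aC0 d x + rT x / s x ^+ 2.
Proof.
move=> Ux; have s0 := s_neq0 Ux.
(* G_0 is written as a polynomial expression in independent scalars and inverses, so that
   conjugation is distributed without entering the derivatives; these are conjugated by their own
   lemmas. *)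
pose g (a b c lb lbb k j f g f0 lf lbf s : C) :=
  - (1 / 4 * (lb / s) * f0) - f0 ^+ 2 + 1 / 2 * (s * g * f0) - 1 / 2 * (s * lf)
  + c * f0 + 1 / 2 * (f * b) + 1 / 4 * (lbb / (b * s)) * f0 + 1 / 2 * (k / s) * f0
  - 1 / 2 * (lbf / s) + j / 2 - 1 / 2 * (a / s) * f0.
have gE : aG0 d x = g (A x) (B x) (aC0 d x) (L B x) (Lb B x) (K x) (J x) (F x) (G x)
  (aF0 d x) (L (aF0 d) x) (Lb (aF0 d) x) (s x) by [].
have g_conj a b c lb lbb k j f g' f0 lf lbf s' :
    (g a b c lb lbb k j f g' f0 lf lbf s')^*%C = g a^*%C b^*%C c^*%C lb^*%C lbb^*%C
      k^*%C j^*%C f^*%C g'^*%C f0^*%C lf^*%C lbf^*%C s'^*%C.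
  by rewrite /g !conj_simp.
rewrite gE g_conj conj_L_F0 // conj_Lb_F0 // !app_q // conj_F0 // conj_C0 // conj_F // conj_J //.
rewrite conj_LB // conj_LbB // conj_G // conj_K // conj_A // conj_BV // conj_sV //.
rewrite sq_s // {gE g_conj}/g.
move: (aF0 d x) (aC0 d x) (L (aF0 d) x) (Lb (aF0 d) x) (L rS x) (Lb rS x) (rT x).
move=> f0 c0 lf lbf ls lbs t.
rewrite /rS sq_s //; move: (L B x) (Lb B x) => lb lbb.
by field.
Qed.


(** * The coframe omega_4 in the dual frame: reality and invertibility *)

Definition c5 (l : seq C) : 'cV[C]_5 := \col_i l`_i.

Lemma mul_c5 (W : 'M[C]_5) (a b c e f : C) : W *m c5 [:: a; b; c; e; f] =
  a *: col 0 W + b *: col 1 W + c *: col 2%:R W + e *: col 3%:R W + f *: col 4%:R W.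
Proof.
apply/colP => i; rewrite !mxE !big_ord_recl big_ord0 !mxE /= addr0 !addrA.
by rewrite ![_ * W _ _]mulrC; congr (W _ _ * _ + W _ _ * _ + W _ _ * _ +
  W _ _ * _ + W _ _ * _); exact: val_inj.
Qed.

Local Notation W x := (invmx (frame v x)).

Lemma tau4E x : tau4 d x = W x *m c5 [:: (B x)^-1; 0; 0; 0; 0].
Proof. by rewrite mul_c5 !scale0r !addr0. Qed.

Lemma sigma4E x :
  sigma4 d x = W x *m c5 [:: aF0 d x / B x; (s x)^-1; 0; 0; 0].
Proof. by rewrite mul_c5 !scale0r !addr0 -scalerA addrC. Qed.

Lemma rho4E x :
  rho4 d x = W x *m c5 [:: aG0 d x / B x; aC0 d x / s x; 1; 0; 0].
Proof.
rewrite mul_c5 !scale0r !addr0 scale1r -!scalerA.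
by rewrite /rho4 addrC [rho1 _ _ + _]addrC addrA.
Qed.

Lemma zeta4E x : zeta4 d x = W x *m c5
  [:: aH0 d x / B x + aD0 d x * aF0 d x / B x; aD0 d x / s x; aB0 d x; (s x)^-1; 0].
Proof.
rewrite mul_c5 scale0r addr0 scalerDl -!scalerA /zeta4 /sigma4 scalerDr.
rewrite /tau1 /sigma1 /rho1 /zeta1 /tau0 /sigma0 /rho0 /zeta0.
move: (col 0 _) (col 1 _) (col 2%:R _) (col 3%:R _) (aB0 d x) (aD0 d x) (aF0 d x) (aH0 d x).
by move=> *; apply/colP => i; rewrite !mxE; ring.
Qed.

(** The rows hold the coordinates of conj(R), conj(S), conj(T), conj(L), conj(Lbar) in the frame;
    short rows are completed by the default value 0. *)
Definition frame_conj x : 'M[C]_5 := \matrix_(i, j)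
  (nth [::] [:: [:: B x ^+ 2; rS x; rT x]; [:: 0; B x; A x]; [:: 0; 0; 1];
               [:: 0; 0; 0; 0; 1]; [:: 0; 0; 0; 1]] i)`_j.

Lemma conj_frame x : U x -> conjmx (frame v x) = frame_conj x *m frame v x.
Proof.
move=> Ux; have cT : conjmx (T x) = T x := conj_T Ux.
have cS : conjmx (S x) = A x *: T x + B x *: S x by have [] := struct Ux.
have cR : conjmx (Rv x) = _ := conj_R Ux.
have cLb : conjmx (conjv v x) = v x := conjmxK _.
apply/row_matrixP => i; rewrite row_mul mulmx_sum_row.
have -> : row i (conjmx (frame v x)) = conjmx (row i (frame v x)).
  by rewrite /conjmx map_row.
rewrite !big_ord_recl big_ord0 !rowK !mxE /=.
case: i => -[|[|[|[|[|//]]]]] i5 /=;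
  rewrite ?cR ?cS ?cT ?cLb ?scale0r ?scale1r ?nth_nil ?addr0 ?add0r //.
  by rewrite addrA.
by rewrite addrC.
Qed.

(** The column [u] lists the values of a covector on the frame. The conjugate covector takes on a
    frame vector the conjugate of the value of the original one on the conjugate vector. *)
Lemma conj_form x (u : 'cV[C]_5) : U x ->
  conjmx (W x *m u) = W x *m conjmx (frame_conj x *m u).
Proof.
move=> Ux; have fu := frame_unit Ux.
rewrite -[LHS](mulKmx fu); congr (_ *m _).
apply: (can_inj (@conjmxK 5 1)).
rewrite [LHS]conjmxM !conjmxK conj_frame //.
by rewrite -!mulmxA mulKVmx.
Qed.

Lemma conj_tau4 x : U x -> conjmx (tau4 d x) = tau4 d x.
Proof.
move=> Ux; have s0 := s_neq0 Ux; rewrite tau4E conj_form //; congr (_ *m _).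
rewrite -[RHS]conjmxK; congr conjmx; apply/colP => i.
rewrite !mxE !big_ord_recl big_ord0 !mxE /= !mulr0 !addr0.
case: i => -[|[|[|[|[|//]]]]] i5 /=;
  rewrite ?nth_nil ?mul0r ?mulr0 ?add0r ?addr0 ?oppr0 //.
by rewrite fmorphV /= conj_BV // sq_s //; field.
Qed.

Lemma conj_sigma4 x : U x -> conjmx (sigma4 d x) = sigma4 d x.
Proof.
move=> Ux; have s0 := s_neq0 Ux; rewrite sigma4E conj_form //; congr (_ *m _).
rewrite -[RHS]conjmxK; congr conjmx; apply/colP => i.
rewrite !mxE !big_ord_recl big_ord0 !mxE /= !mulr0 !addr0.
case: i => -[|[|[|[|[|//]]]]] i5 /=;
  rewrite ?nth_nil ?mul0r ?mulr0 ?add0r ?addr0 ?oppr0 //.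
  rewrite rmorphM fmorphV /= conj_F0 // conj_BV // sq_s //.
  by move: (aF0 d x) (rS x) => f r; field.
by rewrite fmorphV /= conj_sV // sq_s //; field.
Qed.

Lemma conj_rho4 x : U x -> conjmx (rho4 d x) = rho4 d x.
Proof.
move=> Ux; have s0 := s_neq0 Ux; rewrite rho4E conj_form //; congr (_ *m _).
rewrite -[RHS]conjmxK; congr conjmx; apply/colP => i.
rewrite !mxE !big_ord_recl big_ord0 !mxE /= !mulr0 !addr0.
case: i => -[|[|[|[|[|//]]]]] i5 /=;
  rewrite ?nth_nil ?mul0r ?mulr0 ?mulr1 ?add0r ?addr0 ?oppr0 //.
  rewrite rmorphM fmorphV /= conj_G0 // conj_BV // sq_s //.
  by move: (aG0 d x) (aC0 d x) (rS x) (rT x) => g c r t; field.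
rewrite rmorphM fmorphV /= conj_C0 // conj_sV // sq_s //.
by move: (aC0 d x) => c; field.
Qed.

(* In the frame (R, S, T, L, Lbar) the coframe omega_4 is upper triangular. *)
Lemma omega4_unit x : U x -> omega4 d x \in unitmx.
Proof.
move=> Ux; have s0 := s_neq0 Ux; have fu := frame_unit Ux.
suff : frame v x *m omega4 d x \in unitmx by rewrite unitmx_mul => /andP[].
set l := [:: aH0 d x / B x + aD0 d x * aF0 d x / B x; aD0 d x / s x; aB0 d x; (s x)^-1; 0].
have fW (u : 'cV_5) : frame v x *m (W x *m u) = u by rewrite mulKVmx.
have colj (j : 'I_5) : col j (frame v x *m omega4 d x) =
    [:: c5 [:: (B x)^-1; 0; 0; 0; 0]; c5 [:: aF0 d x / B x; (s x)^-1; 0; 0; 0];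
      c5 [:: aG0 d x / B x; aC0 d x / s x; 1; 0; 0]; c5 l;
      conjmx (frame_conj x *m c5 l)]`_j.
  have -> : col j (frame v x *m omega4 d x) = frame v x *m col j (omega4 d x).
    by rewrite !colE mulmxA.
  have -> : col j (omega4 d x) =
      [:: tau4 d x; sigma4 d x; rho4 d x; zeta4 d x; conjmx (zeta4 d x)]`_j.
    by apply/colP => k; rewrite !mxE.
  case: j => -[|[|[|[|[|//]]]]] j5 /=.
  - by rewrite tau4E fW.
  - by rewrite sigma4E fW.
  - by rewrite rho4E fW.
  - by rewrite zeta4E fW.
  - by rewrite zeta4E conj_form // fW.
rewrite -unitmx_tr unitmxE unitfE det_trig; last first.
  apply/is_trig_mxP => i j ij; rewrite mxE.
  have := congr1 (fun w : 'cV_5 => w j 0) (colj i); rewrite mxE => ->.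
  case: i ij => -[|[|[|[|[|//]]]]] i5; case: j => -[|[|[|[|[|//]]]]] j5 //= _;
    by rewrite !mxE.
apply/prodf_neq0 => i _; rewrite mxE.
have := congr1 (fun w : 'cV_5 => w i 0) (colj i); rewrite mxE => ->.
have b0 : B x != 0 by rewrite sq_s // expf_neq0.
case: i => -[|[|[|[|[|//]]]]] i5 /=; rewrite [X in X != 0]mxE /= ?invr_neq0 ?oner_neq0 //.
rewrite (fmorph_eq0 (@conjc R)) [X in X != 0]mxE !big_ord_recl big_ord0 ![frame_conj _ _ _]mxE /=.
by rewrite !mul0r !add0r !addr0 mul1r mxE /= invr_neq0.
Qed.

End StructureFunctions.


(** * Exterior derivatives on the bundle *)

Section ConjugateCoframe.
Context {R : realType}.
Notation C := (R[i]).

Lemma conj_pd_real n (U : set 'rV[R]_n) (f : 'rV[R]_n -> C) i x :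
  open U -> U x -> {in U, forall y, (f y)^*%C = f y} ->
  (pd i f x)^*%C = pd i f x.
Proof.
move=> oU Ux rf; have Im0 : {in U, (fun y => complex.Im (f y)) =1 cst 0}.
  move=> y Uy /=; move: (rf y Uy); case: (f y) => a b [] /eqP.
  by rewrite -subr_eq0 -opprD oppr_eq0 -mulr2n mulrn_eq0 /= => /eqP.
rewrite /pd (near_eq_derive _ (open_near oU Ux Im0)) derive_cst.
by apply/eqP; rewrite eq_complex /= oppr0 !eqxx.
Qed.

Lemma conj_ext_d n (U : set 'rV[R]_n) (al : 'rV[R]_n -> 'cV[C]_n) x :
  open U -> U x -> {in U, forall y, conjmx (al y) = al y} ->
  conjmx (ext_d al x) = ext_d al x.
Proof.
move=> oU Ux ral; apply/matrixP => i j; rewrite !mxE rmorphB /=.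
by congr (_ - _); apply: (conj_pd_real _ oU Ux) => y Uy;
  rewrite -{2}(ral y Uy) mxE.
Qed.

(* When the limit does not exist both sides are the junk value 0. *)
Lemma lim_scale (F : set_system R) (FF : ProperFilter F) (g : R -> R) (r : R) :
  r != 0 -> lim ((fun h => g h * r) @ F) = lim (g @ F) * r.
Proof.
move=> r0; have [cg|dg] := pselect (cvg (g @ F)).
  by apply: cvg_lim => //; exact: cvgMl.
have [cgr|dgr] := pselect (cvg ((fun h => g h * r) @ F)).
  case: dg; have -> : g = (fun h => g h * r * r^-1).
    by apply/funext => h; rewrite mulfK.
  exact: is_cvgMl.
rewrite (dvgP dgr) (dvgP dg).
exact: (esym (mul0r r)).
Qed.

(** The power of a is constant along the directions of the base, and [lim_scale] takes it out of the
    difference quotient for arbitrary [f]. *)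
Lemma pd_lshift (p : 'I_5) (f : 'rV[R]_5 -> C) (w : nat) (y : 'rV[R]_(5 + 1)) :
  aP y != 0 ->
  pd (lshift 1 p) (fun z => f (xP z) * (aP z)%:C%C ^+ w) y =
  pd p f (xP y) * (aP y)%:C%C ^+ w.
Proof.
move=> a0; have r0 : aP y ^+ w != 0 by rewrite expf_neq0.
have aux (g : 'rV[R]_5 -> R) :
    'D_(delta_mx 0 (lshift 1 p)) (fun z : 'rV[R]_(5 + 1) => g (xP z) * aP z ^+ w) y
    = 'D_(delta_mx 0 p) g (xP y) * aP y ^+ w.
  rewrite /derive -lim_scale //.
  suff -> : (fun h : R => h^-1 *: (((fun z => g (xP z) * aP z ^+ w) \o shift y)
      (h *: delta_mx 0 (lshift 1 p)) - g (xP y) * aP y ^+ w)) =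
      (fun h => h^-1 *: ((g \o shift (xP y)) (h *: delta_mx 0 p) - g (xP y))
                * aP y ^+ w) by [].
  apply/funext => h /=.
  have -> : xP (h *: delta_mx 0 (lshift 1 p) + y) = h *: delta_mx 0 p + xP y.
    by apply/rowP => j; rewrite !mxE eqxx /= (inj_eq (@lshift_inj _ _)).
  have -> : aP (h *: delta_mx 0 (lshift 1 p) + y) = aP y.
    by rewrite /aP !mxE eq_rlshift andbF mulr0 add0r.
  by rewrite -mulrBl -scalerAl.
have toCX (z : 'rV[R]_(5 + 1)) : (aP z)%:C%C ^+ w = (aP z ^+ w)%:C%C.
  by rewrite rmorphXn.
have -> : (fun z => f (xP z) * (aP z)%:C%C ^+ w) =
    (fun z => f (xP z) * (aP z ^+ w)%:C%C) by apply/funext => z; rewrite toCX.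
rewrite toCX /pd.
have -> : (fun z => complex.Re (f (xP z) * (aP z ^+ w)%:C%C)) =
    (fun z => (@complex.Re R \o f) (xP z) * aP z ^+ w).
  by apply/funext => z /=; case: (f (xP z)) => b c /=; rewrite mulr0 subr0.
have -> : (fun z => complex.Im (f (xP z) * (aP z ^+ w)%:C%C)) =
    (fun z => (@complex.Im R \o f) (xP z) * aP z ^+ w).
  by apply/funext => z /=; case: (f (xP z)) => b c /=; rewrite mulr0 add0r.
rewrite !aux; set b := 'D__ _ _; set c := 'D__ _ _.
by apply/eqP; rewrite eq_complex /= !mulr0 subr0 add0r !eqxx.
Qed.

End ConjugateCoframe.


(** * The adapted coframe in a chart *)

Section Charts.
Context {R : realType} {M : smooth_manifold R 5}.
Notation C := (R[i]).

Lemma par_im (c : chart M) (W : set M) x : im c W x ->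
  [/\ dom c (par c x), W (par c x) & coord c (par c x) = x].
Proof. by case=> p [cp Wp] <-; rewrite coordK. Qed.

Lemma open_im (c : chart M) (W : set M) : open W -> open (im c W).
Proof.
move=> oW; rewrite openE => x imx; have [cp Wp xE] := par_im imx.
have ox : (coord c @` dom c) x by exists (par c x).
have n1 := open_nbhs_nbhs (conj (coord_open (c := c)) ox).
have n2 := par_continuous ox (open_nbhs_nbhs (conj oW Wp)).
apply: filterS2 n1 n2 => z [p cp' <-] /= Wz; exists p => //.
by split=> //; move: Wz; rewrite coordK.
Qed.

Definition swap_zeta : 'S_5 := tperm 3%:R 4%:R.

Variables (L : CR_structure M) (hM : class_III2 L).
Variables (D : adapted_generator L) (c : chart M).
Local Notation U := (im c (gdom D)).
Local Notation d := (in_chart D c).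

Let oU : open U. Proof. exact/open_im/gdom_open. Qed.

(** The last rank condition of the class concerns the same five vectors in another order; comparing
    row spaces makes the order irrelevant. *)
Lemma frame_unitmx x : U x -> frame (vL d) x \in unitmx.
Proof.
move=> Ux; have [_ _ _] := hM (gdom_open D) (gvL_generator D) Ux.
rewrite /span_rank; set m := \matrix_i _ => rk.
rewrite -row_free_unit /row_free eqn_leq rank_leq_row /=.
apply: (leq_trans (eq_leq (esym rk))); apply: mxrankS.
apply/row_subP => i; rewrite rowK.
have rowf (j : 'I_5) : (row j (frame (vL d) x) <= frame (vL d) x)%MS by exact: row_sub.
case: i => -[|[|[|[|[|//]]]]] i5 /=.
- by have := rowf 3%:R; rewrite rowK.
- by have := rowf 4%:R; rewrite rowK.
- by have := rowf 2%:R; rewrite rowK.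
- by have := rowf 1; rewrite rowK.
- by have := rowf 0; rewrite rowK.
Qed.

Lemma adapted_coframe x : U x ->
  [/\ omega4 d x \in unitmx,
      conjmx (omega4 d x) = omega4 d x *m perm_mx swap_zeta
    & (I1 d x)^*%C = - I1 d x].
Proof.
move=> Ux; have [[[sX _] _] [[sA sB _ _ sG] [_ _ sK ss]]] :=
  (gvL_generator D, gfun_smooth D).
have sv : vsmooth_on U (vL d) by move=> j; exact: sX.
have str : forall y, U y -> structure_equations d y by move=> y; exact: gstructure.
split.
- exact: (omega4_unit oU sv (sA c) (sB c) str frame_unitmx Ux).
- have t4 := conj_tau4 oU sv (sA c) (sB c) str frame_unitmx Ux.
  have s4 := conj_sigma4 oU sv (sA c) (sB c) (ss c) str frame_unitmx Ux.
  have r4 := conj_rho4 oU sv (sA c) (sB c) (sG c) (sK c) (ss c) str frame_unitmx Ux.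
  have -> : perm_mx swap_zeta = perm_mx swap_zeta^-1 :> 'M[C]_5 by rewrite tpermV.
  rewrite -col_permE; apply/matrixP => k j; rewrite !mxE.
  have col4 (u : 'cV[C]_5) : conjmx u = u -> ((u k 0)^*%C = u k 0).
    by move=> {2}<-; rewrite mxE.
  case: j => -[|[|[|[|[|//]]]]] j5.
  + by rewrite tpermD // col4.
  + by rewrite tpermD // col4.
  + by rewrite tpermD // col4.
  + rewrite (_ : Ordinal j5 = 3%:R); last exact: val_inj.
    by rewrite tpermL [RHS]mxE.
  + rewrite (_ : Ordinal j5 = 4%:R); last exact: val_inj.
    by rewrite tpermR /= [X in X^*%C]mxE conjcK.
- exact: (conj_I1 oU sv (sA c) (sB c) (ss c) str frame_unitmx Ux).
Qed.

End Charts.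


(** * The form Lambda *)

Section Lambda.
Context {R : realType}.
Notation C := (R[i]).

Lemma wedgeE n (u w : 'cV[C]_n) p q :
  wedge u w p q = u p 0 * w q 0 - w p 0 * u q 0.
Proof. by rewrite !mxE !big_ord1 !mxE. Qed.

Lemma mul_wedge_tr m n (N : 'M[C]_(m, n)) (u w : 'cV[C]_n) :
  N *m wedge u w *m N^T = wedge (N *m u) (N *m w).
Proof. by rewrite /wedge mulmxBr mulmxBl !trmx_mul !mulmxA. Qed.

Definition theta (d : @local_data R) (j : 'I_5) (x : 'rV[R]_5) : 'cV[C]_5 :=
  col j (omega4 d x).

(** The entry (p, q) is the coefficient of theta_p /\ theta_q in d theta_j, since the inverse matrix
    sends theta_p to the p-th basis column. *)
Definition dtheta d j x : 'M[C]_5 :=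
  invmx (omega4 d x) *m ext_d (theta d j) x *m (invmx (omega4 d x))^T.

(* The coordinates of da/a - Lambda in the coframe omega_4: the entry of index
   0 comes from the tau /\ sigma term of feature (ii), the other entries from the
   terms tau /\ theta_j of feature (i). *)
Definition Lambda_coord (d : @local_data R) (x : 'rV[R]_5) : 'cV[C]_5 :=
  \col_j if j == 0 then - (dtheta d 1 x 0 1 / 3)
         else (dtheta d 0 x 0 j - I1 d x *+ (j == 3%:R) + I1 d x *+ (j == 4%:R)) / 4.

Definition weight (j : 'I_5) : nat := nth 0 [:: 4; 3; 2; 1; 1]%N j.

Lemma mul_G5E m (a : R) (N : 'M[C]_(m, 5)) i j :
  (N *m G5 a) i j = N i j * a%:C%C ^+ weight j.
Proof. by rewrite /G5 mul_mx_diag !mxE. Qed.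

Context {M : smooth_manifold R 5} {L : CR_structure M} {I : Type}.
Variables (D : I -> adapted_generator L) (k : @Pchart R M I).
Variable Lam : @Pchart R M I -> 'rV[R]_(5 + 1) -> 'cV[C]_(5 + 1).
Variable y : 'rV[R]_(5 + 1).
Local Notation d := (in_chart (D k.2) k.1).
Local Notation x := (xP y).
Local Notation a := (aP y).
Local Notation N := (invmx (omega4 d x)).

Lemma tautE j z q : taut D k j z (lshift 1 q) 0 =
  theta d j (xP z) q 0 * (aP z)%:C%C ^+ weight j.
Proof. by rewrite mxE /taut_mx col_mxEu mul_G5E [in RHS]mxE. Qed.

Lemma usub_taut j : usubmx (taut D k j y) = a%:C%C ^+ weight j *: theta d j x.
Proof. by apply/colP => i; rewrite mxE tautE [RHS]mxE mulrC. Qed.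

(** Taking the upper left block means working modulo da, and differentiating the factor a^w
    contributes only multiples of da. *)
Lemma ulsub_ext_d_taut j : a != 0 ->
  ulsubmx (ext_d (taut D k j) y) = a%:C%C ^+ weight j *: ext_d (theta d j) x.
Proof.
move=> a0; have fE q : (fun z => taut D k j z (lshift 1 q) 0) =
    (fun z => theta d j (xP z) q 0 * (aP z)%:C%C ^+ weight j).
  by apply/funext => z; exact: tautE.
have dE n (al : 'rV[R]_n -> 'cV[C]_n) z p q : ext_d al z p q =
    pd p (fun z => al z q 0) z - pd q (fun z => al z p 0) z by rewrite mxE.
apply/matrixP => p q; rewrite [LHS]mxE [LHS]mxE dE !fE [RHS]mxE dE.
rewrite (pd_lshift p (fun z => theta d j z q 0) _ a0).
by rewrite (pd_lshift q (fun z => theta d j z p 0) _ a0) -mulrBl mulrC.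
Qed.

Lemma ulsub_wedge (u w : 'cV[C]_(5 + 1)) :
  ulsubmx (wedge u w) = wedge (usubmx u) (usubmx w).
Proof.
apply/matrixP => p q; rewrite wedgeE !mxE !big_ord1 !mxE.
by [].
Qed.


Hypotheses (Lmod : modified_MC D Lam k) (Ldtau : feature_dtau D Lam k)
  (Ldsigma : feature_dsigma D Lam k) (yk : Pim D k y).
Hypothesis ou : omega4 d x \in unitmx.

Let aC : a%:C%C != 0 :> C.
Proof. by have [_ a0] := yk; rewrite (fmorph_eq0 (real_complex R)). Qed.

(* the coefficient of theta_0 /\ theta_j, modulo da *)
Let phi (j : 'I_5) (Q : 'M[C]_(5 + 1)) : C := (N *m ulsubmx Q *m N^T) 0 j.

Let phiD j P Q : phi j (P + Q) = phi j P + phi j Q.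
Proof.
rewrite /phi; have -> : ulsubmx (P + Q) = ulsubmx P + ulsubmx Q by apply/matrixP => p q; rewrite !mxE.
by rewrite mulmxDr mulmxDl mxE.
Qed.

Let phiZ j b Q : phi j (b *: Q) = b * phi j Q.
Proof.
rewrite /phi; have -> : ulsubmx (b *: Q) = b *: ulsubmx Q by apply/matrixP => p q; rewrite !mxE.
by rewrite -scalemxAr -scalemxAl mxE.
Qed.

Let phiN j Q : phi j (- Q) = - phi j Q.
Proof. by rewrite -scaleN1r phiZ mulN1r. Qed.

Let phi_sum j (J : finType) (P : pred J) (F : J -> 'M[C]_(5 + 1)) :
  phi j (\sum_(i | P i) F i) = \sum_(i | P i) phi j (F i).
Proof.
apply: (big_morph (phi j)) => [P' Q'|]; first exact: phiD.
by rewrite -(scale0r 0) phiZ mul0r.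
Qed.

Let phi_wedge j (u w : 'cV[C]_(5 + 1)) u0 uj w0 wj :
  (N *m usubmx u) 0 0 = u0 -> (N *m usubmx u) j 0 = uj ->
  (N *m usubmx w) 0 0 = w0 -> (N *m usubmx w) j 0 = wj ->
  phi j (wedge u w) = u0 * wj - w0 * uj.
Proof. by move=> <- <- <- <-; rewrite /phi ulsub_wedge mul_wedge_tr wedgeE. Qed.

Let phi_ext_d i j : phi j (ext_d (taut D k i) y) = a%:C%C ^+ weight i * dtheta d i x 0 j.
Proof.
by rewrite /phi ulsub_ext_d_taut ?(proj2 yk) // -scalemxAr -scalemxAl mxE.
Qed.

Let N_taut i j : (N *m usubmx (taut D k i y)) j 0 =
  a%:C%C ^+ weight i * (j == i)%:R.
Proof.
by rewrite usub_taut -scalemxAr mxE /theta colE mulKmx // !mxE andbT.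
Qed.

Let phi_wedge_taut i l j : phi j (wedge (taut D k i y) (taut D k l y)) =
  a%:C%C ^+ weight i * (0 == i)%:R * (a%:C%C ^+ weight l * (j == l)%:R) -
  a%:C%C ^+ weight l * (0 == l)%:R * (a%:C%C ^+ weight i * (j == i)%:R).
Proof. exact: phi_wedge (N_taut i 0) (N_taut i j) (N_taut l 0) (N_taut l j). Qed.

Let phi_dtau j (P w1 w2 w3 w4 w5 w6 : 'M[C]_(5 + 1)) (b e f p1 p2 p3 p4 p5 p6 p : C) :
  phi j P = p -> phi j w1 = p1 -> phi j w2 = p2 -> phi j w3 = p3 ->
  phi j w4 = p4 -> phi j w5 = p5 -> phi j w6 = p6 ->
  P - b *: w1 - e *: w2 + e *: w3 - w4 - w5 = f *: w6 ->
  p - b * p1 - e * p2 + e * p3 - p4 - p5 = f * p6.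
Proof.
move=> <- <- <- <- <- <- <- /(congr1 (phi j)).
by rewrite 5!phiD 4!phiN !phiZ.
Qed.

Lemma Lambda_normal_form :
  Lam k y = col_mx (- (omega4 d x *m Lambda_coord d x)) (a%:C%C^-1)%:M.
Proof.
have [X EX] := Lmod yk.
have dL : dsubmx (Lam k y) = (a%:C%C^-1)%:M.
  rewrite EX /taut_mx mul_col_mx mul0mx /form_da linearB linearZ /= !col_mxKd.
  by rewrite subr0 scalemx1.
pose Z := G5 a *m X.
have uL : usubmx (Lam k y) = - (omega4 d x *m Z).
  rewrite EX /taut_mx mul_col_mx mul0mx /form_da linearB linearZ /= !col_mxKu.
  by rewrite scaler0 sub0r mulmxA.
rewrite -[LHS]vsubmxK dL uL; congr (col_mx (- (_ *m _)) _).
have NL j : (N *m usubmx (Lam k y)) j 0 = - Z j 0.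
  by rewrite uL mulmxN mulKmx // mxE.
apply/colP => j; rewrite [RHS]mxE; case: eqVneq => [->|j0].
  have [f f01 /(congr1 (phi 1))] := Ldsigma yk.
  rewrite phiD phiN phiZ (phi_wedge (NL 0) (NL 1) (N_taut 1 0) (N_taut 1 1)) phi_ext_d /= phi_sum big1; last first.
    (* Among the products of two tautological forms only tau /\ sigma has a theta_0 /\ theta_1
       component, and its coefficient is 0 by feature (ii). *)
    move=> p _; rewrite phi_sum big1 // => q pq; rewrite phiZ phi_wedge_taut.
    have q0 : (0 == q) = false by apply/eqP => q0; rewrite -q0 ltn0 in pq.
    rewrite q0 mulr0 mul0r subr0; case: eqVneq => [<-|_]; last by rewrite mulr0 mul0r mulr0.
    by case: eqVneq => [<-|_]; rewrite ?f01 ?mul0r // !mulr0.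
  have := expf_neq0 (weight 1) aC; move: (a%:C%C ^+ _) => A A0.
  move: (dtheta _ _ _ _ _) (Z 0 0) (Z 1 0) => m z0 z1 EA; apply: (mulfI A0).
  (* The numerator 0 stands for the vanishing expression in [EA]; once it is put back, a field
     identity remains. *)
  have -> : A * z0 = - (A * (m / 3)) + 0 / 3 by rewrite -EA; field.
  by rewrite mul0r addr0 mulrN.
have phi_Lam i l := phi_wedge (NL 0) (NL l) (N_taut i 0) (N_taut i l).
have [f] := Ldtau yk.
(* The products without tau have no theta_0 /\ theta_j component, so the unknown multiple of sigma
   /\ rho disappears along with the last two terms on the left. *)
move/(phi_dtau (phi_ext_d 0 j) (phi_Lam 0 j) (phi_wedge_taut 0 3%:R j)
  (phi_wedge_taut 0 4%:R j) (phi_wedge_taut 1 3%:R j) (phi_wedge_taut 1 4%:R j)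
  (phi_wedge_taut 1 2%:R j)).
rewrite /= (negPf j0).
move: (Z 0 0) (Z j 0) (dtheta _ _ _ _ _) (I1 _ _) aC => z0 z m i1 A0.
rewrite /weight /=.
move=> EA; move/eqP: EA; rewrite -subr_eq0 => /eqP EA.
(* Adds the vanishing expression in [EA] divided by 4 a^4, the coefficient of the unknown up to
   sign. *)
rewrite -[LHS]addr0 -(mul0r (4 * a%:C%C ^+ 4)^-1) -EA.
case: (j == 3%:R); case: (j == 4%:R); rewrite /= ?mulr0n ?mulr1n; field; exact: A0.
Qed.

End Lambda.


(** * Reality of the base part of Lambda *)

Section Reality.
Context {R : realType}.
Notation C := (R[i]).
Local Notation Q := (perm_mx swap_zeta : 'M[C]_5).

Lemma real_mx m n (w : 'M[C]_(m, n)) : conjmx w = w -> exists v, toC v = w.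
Proof.
move=> rw; exists (map_mx (@complex.Re R) w); apply/matrixP => i j.
have := congr1 (fun M : 'M[C]_(m, n) => M i j) rw; rewrite !mxE.
case: (w i j) => a b [] /eqP; rewrite -subr_eq0 -opprD oppr_eq0 -mulr2n.
by rewrite mulrn_eq0 /= => /eqP ->.
Qed.

Lemma conj_toC m n (v : 'M[R]_(m, n)) : conjmx (toC v) = toC v.
Proof. by apply/matrixP => i j; rewrite !mxE conjc_real. Qed.

Lemma swap_zetaK : Q *m Q = 1%:M.
Proof. by rewrite -perm_mxM tperm2 perm_mx1. Qed.

Lemma weight_swap j : weight (swap_zeta j) = weight j.
Proof. by rewrite /swap_zeta; case: tpermP => [->|->|]. Qed.

Lemma swap_zeta_eq i j : (swap_zeta i == j) = (i == swap_zeta j).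
Proof. by rewrite -(inj_eq (@perm_inj _ swap_zeta)) tpermK. Qed.

Lemma G5_swap (a : R) : Q *m G5 a = G5 a *m Q.
Proof.
have tQ : Q = perm_mx swap_zeta^-1 by rewrite tpermV.
rewrite [in RHS]tQ -row_permE -col_permE.
apply/matrixP => i j; rewrite !mxE swap_zeta_eq.
by rewrite -/(weight (swap_zeta i)) weight_swap.
Qed.

Lemma conj_G5 (a : R) : conjmx (G5 a) = G5 a.
Proof.
apply/matrixP => i j; rewrite [LHS]mxE mxE; case: (i == j); last exact: conjc0.
by rewrite mulr1n mxE -rmorphXn conjc_real.
Qed.

Lemma G5M (a b : R) : G5 a *m G5 b = G5 (a * b).
Proof.
apply/matrixP => i j; rewrite mul_G5E !mxE; case: eqVneq => [->|_].
  by rewrite !mulr1n rmorphM exprMn.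
by rewrite !mulr0n mul0r.
Qed.

Lemma G51 : G5 (1 : R) = 1%:M.
Proof. by apply/matrixP => i j; rewrite !mxE expr1n. Qed.

Lemma conj_invmx (O : 'M[C]_5) : O \in unitmx -> conjmx O = O *m Q ->
  conjmx (invmx O) = Q *m invmx O.
Proof.
move=> uO cO; have : conjmx O *m conjmx (invmx O) = 1%:M.
  by rewrite -conjmxM mulmxV // /conjmx map_mx1.
rewrite cO -mulmxA => /(congr1 (fun P => Q *m (invmx O *m P))).
by rewrite mulKmx // mulmx1 mulmxA swap_zetaK mul1mx.
Qed.

Section AtPoint.
Variables (d : @local_data R) (U : set 'rV[R]_5) (x : 'rV[R]_5).
Hypotheses (oU : open U) (Ux : U x).
Hypothesis adapted : forall z, U z -> [/\ omega4 d z \in unitmx,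
  conjmx (omega4 d z) = omega4 d z *m Q & (I1 d z)^*%C = - I1 d z].

Lemma conj_theta (j : 'I_5) : swap_zeta j = j ->
  {in U, forall z, conjmx (theta d j z) = theta d j z}.
Proof.
move=> sj z; rewrite inE => /adapted[_ cO _].
have -> : conjmx (theta d j z) = col j (conjmx (omega4 d z)).
  by rewrite /conjmx map_col.
have tQ : Q = perm_mx swap_zeta^-1 by rewrite tpermV.
by rewrite cO tQ -col_permE; apply/colP => i; rewrite !mxE sj.
Qed.

Lemma conj_dtheta (j : 'I_5) p q : swap_zeta j = j ->
  (dtheta d j x p q)^*%C = dtheta d j x (swap_zeta p) (swap_zeta q).
Proof.
move=> sj; have [uO cO _] := adapted Ux.
have cd := conj_ext_d oU Ux (conj_theta sj).
have : conjmx (dtheta d j x) = Q *m dtheta d j x *m Q^T.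
  rewrite /dtheta !conjmxM cd conj_invmx // -!mulmxA; congr (_ *m (_ *m (_ *m _))).
  have -> : conjmx (invmx (omega4 d x))^T = (conjmx (invmx (omega4 d x)))^T.
    by rewrite /conjmx map_trmx.
  by rewrite conj_invmx // trmx_mul.
rewrite tr_perm_mx -row_permE -col_permE => /matrixP/(_ p q).
by rewrite mxE => ->; rewrite !mxE.
Qed.

(** Conjugation must permute the coordinates by [swap_zeta]. The coefficients of the derivatives of
    the real forms tau_4 and sigma_4 do so, and the terms -I_1 at index 3 and +I_1 at index 4 are
    exchanged because I_1 is imaginary. *)
Lemma conj_Lambda_form :
  conjmx (omega4 d x *m Lambda_coord d x) = omega4 d x *m Lambda_coord d x.
Proof.
have [uO cO cI] := adapted Ux; rewrite conjmxM cO -mulmxA; congr (_ *m _).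
rewrite -row_permE; apply/colP => j; rewrite mxE mxE mxE [RHS]mxE.
have s0 : swap_zeta 0 = 0 by rewrite tpermD.
have s1 : swap_zeta 1 = 1 by rewrite tpermD.
rewrite !swap_zeta_eq s0 tpermL tpermR; case: ifP => _.
  by rewrite rmorphN rmorphM fmorphV rmorph_nat /= conj_dtheta // s0 s1.
rewrite rmorphM fmorphV rmorph_nat rmorphD rmorphB !rmorphMn /= conj_dtheta //.
rewrite s0 tpermK cI !mulNrn opprK; congr (_ / _).
by rewrite addrAC.
Qed.

End AtPoint.
End Reality.


(** * The Cartan connection *)

Section Linear.
Context {R : realType}.

Lemma differentiable_mulmxr m n (B : 'M[R]_(m, n)) (z : 'rV[R]_m) :
  differentiable (mulmxr B : 'rV[R]_m -> 'rV[R]_n) z.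
Proof.
have -> : (mulmxr B : 'rV[R]_m -> 'rV[R]_n) =
    \sum_(i < m) (fun z : 'rV[R]_m => z 0 i *: row i B).
  apply/funext => u /=; rewrite mulmx_sum_row.
  by elim/big_ind2: _ => // f g u1 u2 -> ->.
apply: differentiable_sum => i.
exact/differentiableZl/differentiable_coord.
Qed.

(** Meant for the right action, which is known to agree with a linear map only on the open set
    [Pim]; hence equality near the point is assumed. *)
Lemma mulmx_jacobian m n (f : 'rV[R]_m -> 'rV[R]_n) (B : 'M[R]_(m, n))
    (z v : 'rV[R]_m) :
  {near z, mulmxr B =1 f} -> v *m 'J f z = v *m B.
Proof.
move=> fB; rewrite /jacobian mul_rV_lin1 (near_eq_diff fB); last first.
  exact: differentiable_mulmxr.
rewrite diff_lin // => u; exact/differentiable_continuous/differentiable_mulmxr.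
Qed.

End Linear.

(** * Adjoint action and conjugation of g in block form *)

Section LieAlgebraBlocks.
Context {R : realType}.
Notation C := (R[i]).

Lemma inord_lshift : inord 0 = lshift 5 (0 : 'I_1) :> 'I_6.
Proof. by apply: val_inj; rewrite /= inordK. Qed.

Lemma inord_rshift (i : 'I_5) : inord i.+1 = rshift 1 i :> 'I_6.
Proof. by apply: val_inj; rewrite /= inordK // ltnS. Qed.

Lemma Ad_row_mx (a : R) (p : 'M[C]_1) (q : 'rV[C]_5) :
  Ad a (row_mx p q) = row_mx p (q *m G5 a^-1).
Proof.
apply/rowP => j; rewrite [LHS]mxE; case: (split_ordP (j : 'I_(1 + 5))) => i ->.
  by rewrite !row_mxEl ord1 /= invr1 mul1r.
rewrite !row_mxEr mul_G5E mulrC fmorphV exprVn.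
by congr (_ * (_ ^+ _)^-1); case: i => -[|[|[|[|[|//]]]]].
Qed.

Lemma swap_zeta_val (i : 'I_5) : swap_zeta i = nth 0 [:: 0; 1; 2; 4; 3] i :> nat.
Proof.
case: i => -[|[|[|[|[|//]]]]] i5; try by rewrite tpermD.
  by rewrite (_ : Ordinal i5 = 3%:R); [rewrite tpermL|exact: val_inj].
by rewrite (_ : Ordinal i5 = 4%:R); [rewrite tpermR|exact: val_inj].
Qed.

Lemma g_conj_row_mx (p : 'M[C]_1) (q : 'rV[C]_5) :
  g_conj (row_mx p q) = row_mx (conjmx p) (conjmx q *m perm_mx swap_zeta).
Proof.
have tQ : perm_mx swap_zeta = perm_mx swap_zeta^-1 :> 'M[C]_5 by rewrite tpermV.
rewrite tQ -col_permE; apply/rowP => j; rewrite [LHS]mxE.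
case: (split_ordP (j : 'I_(1 + 5))) => i ->.
  by rewrite row_mxEl [RHS]mxE ord1 [nth _ _ _]/= inord_lshift row_mxEl.
rewrite row_mxEr [in RHS]mxE [in RHS]mxE.
have -> : nth 0%N [:: 0; 1; 2; 3; 5; 4]%N (rshift 1 i) = (swap_zeta i).+1.
  by rewrite swap_zeta_val; case: i => -[|[|[|[|[|//]]]]].
by rewrite inord_rshift row_mxEr.
Qed.

Lemma e_alphaE : e_alpha = row_mx 1%:M 0 :> @gC R.
Proof.
apply/rowP => j; rewrite [LHS]mxE inord_lshift /=.
case: (split_ordP (j : 'I_(1 + 5))) => i ->.
  by rewrite row_mxEl !ord1 mxE !eqxx.
by rewrite row_mxEr mxE eq_rlshift.
Qed.

End LieAlgebraBlocks.

(** * The properties of the connection in a trivialization *)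

Section Connection.
Context {R : realType} {M : smooth_manifold R 5} {L : CR_structure M} {I : Type}.
Notation C := (R[i]).
Hypothesis hM : class_III2 L.
Variable D : I -> adapted_generator L.

Lemma act_coframe i (a b : R) p :
  act b (coframe (D i) a p) = coframe (D i) (a * b) p.
Proof.
congr (_, _); apply/funext => c /=; case: ifP => _; last by rewrite mul0mx.
by rewrite -mulmxA G5M.
Qed.

Lemma fibre_coord_coframe i (c : chart M) (a : R) p : dom c p -> gdom (D i) p ->
  a != 0 -> fibre_coord D i (coframe (D i) a p) = a.
Proof.
move=> cp ip a0; apply: xget_unique; first by [].
move=> b [_ /(congr1 (fun u => u.2 c))] /=; rewrite asboolT //.
have Ux : im c (gdom (D i)) (coord c p) by exists p.
have [uO _ _] := adapted_coframe hM Ux.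
(* The diagonal entry of zeta has weight one and so returns the parameter with its sign, which an
   even power would lose. *)
move=> /(can_inj (mulKmx uO)) /matrixP/(_ 3%:R 3%:R).
by rewrite !mxE eqxx !mulr1n !expr1 => /(fmorph_inj (real_complex R)).
Qed.

Lemma PimP (k : @Pchart R M I) x a : im k.1 (gdom (D k.2)) x -> a != 0 ->
  Pim D k (row_mx x a%:M).
Proof.
by move=> imx a0; rewrite /Pim /= /xP /aP row_mxKl row_mxKr mxE eqxx mulr1n.
Qed.

Lemma nbhs_Pim (k : @Pchart R M I) y : Pim D k y -> nbhs y (Pim D k).
Proof.
move=> [imx a0]; apply: filterI.
  apply: (@continuous_lsubmx R 1 5 1 y).
  by apply: open_nbhs_nbhs; split=> //; exact/open_im/gdom_open.
have ca : {for y, continuous (@aP R)}.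
  have -> : @aP R = (fun z => z 0 (rshift 5 0)) by apply/funext => z; rewrite /aP mxE.
  exact/differentiable_continuous/differentiable_coord.
by apply: (ca [set r | r != 0]); apply: open_nbhs_nbhs.
Qed.

Lemma R_chartE (k : @Pchart R M I) (b : R) y : b != 0 -> Pim D k y ->
  R_chart D k b y = y *m block_mx 1%:M 0 0 b%:M.
Proof.
move=> b0 [imx a0]; have [cp ip xE] := par_im imx.
rewrite /R_chart /Ppar act_coframe /Pcoord /= xE.
rewrite (fibre_coord_coframe cp ip) ?mulf_neq0 //.
rewrite -[in RHS](hsubmxK y) mul_row_block !mulmx0 addr0 add0r mulmx1.
by rewrite mul_mx_scalar [rsubmx y]mx11_scalar scale_scalar_mx mulrC.
Qed.

Variables (P : set (@coframe_pt R M)) (hP : is_P5 D P).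
Variables (Lam : @Pchart R M I -> 'rV[R]_(5 + 1) -> 'cV[C]_(5 + 1)).
Hypothesis hLam : is_Lambda D P Lam.

Local Notation loc k := (in_chart (D k.2) k.1).
Local Notation Om k x := (omega4 (loc k) x).
Local Notation lam k x := (Om k x *m Lambda_coord (loc k) x).

Lemma cartan_formE (k : @Pchart R M I) (y v : 'rV[R]_(5 + 1)) : Pim D k y ->
  cartan_form D Lam k y v =
  row_mx (((rsubmx v 0 0)%:C%C / (aP y)%:C%C)%:M - toC (lsubmx v) *m lam k (xP y))
         (toC (lsubmx v) *m Om k (xP y) *m G5 (aP y)).
Proof.
move=> yk; have [uO _ _] := adapted_coframe hM yk.1; have [_ /(_ k) [F1 F2 F3]] := hLam.
rewrite /cartan_form (Lambda_normal_form F1 F2 F3 yk uO) mul_mx_row.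
rewrite -{1 2}[v]hsubmxK {1 2}/toC map_row_mx /taut_mx !mul_row_col mulmx0 addr0.
rewrite mulmxA mulmxN addrC; congr (row_mx (_ - _) _).
by rewrite [map_mx _ (rsubmx v)]mx11_scalar mxE -scalar_mxM.
Qed.

Lemma cartan_form_real (k : @Pchart R M I) (y v : 'rV[R]_(5 + 1)) : Pim D k y ->
  in_g (cartan_form D Lam k y v).
Proof.
move=> yk; have ad := fun z => @adapted_coframe R M L hM (D k.2) k.1 z.
have [uO cO _] := ad _ yk.1; have oU := open_im (c := k.1) (gdom_open (D k.2)).
rewrite /in_g cartan_formE // g_conj_row_mx; congr row_mx.
  have -> (p q : 'M[C]_1) : conjmx (p - q) = conjmx p - conjmx q.
    by apply/matrixP => i j; rewrite !mxE rmorphB.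
  rewrite [in LHS]conjmxM conj_toC (conj_Lambda_form oU yk.1 ad); congr (_ - _).
  apply/matrixP => i j; rewrite !mxE !ord1 !mulr1n.
  by rewrite rmorphM fmorphV; congr (_ / _); exact: conjc_real.
rewrite !conjmxM conj_toC cO conj_G5 -!mulmxA; congr (_ *m (_ *m _)).
by rewrite -G5_swap mulmxA swap_zetaK mul1mx.
Qed.

(** The action multiplies both the fibre component of [v] and the fibre coordinate by b, which
    preserves da/a, and lam lives on the base; the other five coordinates acquire the factor [G5 b],
    that is, Ad of the inverse of b. *)
Lemma cartan_form_equivariant (k : @Pchart R M I) (x : 'rV[R]_5) (a b : R) v :
  im k.1 (gdom (D k.2)) x -> a != 0 -> b != 0 ->
  cartan_form D Lam k (row_mx x (a * b)%:M) (v *m block_mx 1%:M 0 0 b%:M) =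
  Ad b^-1 (cartan_form D Lam k (row_mx x a%:M) v).
Proof.
move=> imx a0 b0; have ab0 : a * b != 0 by rewrite mulf_neq0.
rewrite !cartan_formE; try exact: PimP.
rewrite Ad_row_mx invrK /xP /aP !row_mxKl !row_mxKr.
have -> : v *m block_mx 1%:M 0 0 b%:M = row_mx (lsubmx v) (b *: rsubmx v).
  rewrite -{1}[v]hsubmxK mul_row_block !mulmx0 addr0 add0r mulmx1.
  by rewrite mul_mx_scalar.
have s11 (r : R) : (r%:M : 'M[R]_1) 0 0 = r by rewrite mxE eqxx.
rewrite row_mxKl row_mxKr !s11 -(mulmxA _ (G5 a) (G5 b)) G5M.
congr (row_mx (_%:M - _) _).
have [A0 B0] : a%:C%C != 0 :> C /\ b%:C%C != 0 :> C by rewrite !fmorph_eq0.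
rewrite !mxE !rmorphM /=; move: (rsubmx v 0 0)%:C%C => r; field.
by rewrite A0.
Qed.

(** The system is triangular: the last five coordinates determine the base component of the vector,
    and the coordinate along e_alpha then determines the fibre component. Both solutions are real
    because [xi] lies in g and lam is real. *)
Lemma cartan_form_bij (k : @Pchart R M I) (y : 'rV[R]_(5 + 1)) (xi : gC) :
  Pim D k y -> in_g xi -> exists! v, cartan_form D Lam k y v = xi.
Proof.
move=> yk; have ad := fun z => @adapted_coframe R M L hM (D k.2) k.1 z.
have [uO cO _] := ad _ yk.1; have oU := open_im (c := k.1) (gdom_open (D k.2)).
have a0 := yk.2; have A0 : (aP y)%:C%C != 0 :> C by rewrite fmorph_eq0.
have cl := conj_Lambda_form oU yk.1 ad.
have GK m (q : 'M[C]_(m, 5)) : q *m G5 (aP y) *m G5 (aP y)^-1 = q.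
  by rewrite -mulmxA G5M mulfV // G51 mulmx1.
have GKV m (q : 'M[C]_(m, 5)) : q *m G5 (aP y)^-1 *m G5 (aP y) = q.
  by rewrite -mulmxA G5M mulVf // G51 mulmx1.
have inj v v' : cartan_form D Lam k y v = cartan_form D Lam k y v' -> v = v'.
  rewrite !cartan_formE // => /eq_row_mx[Ep Eq].
  have El : lsubmx v = lsubmx v'.
    apply: (map_mx_inj (f := real_complex R)) => //.
    by move: Eq => /(congr1 (mulmx^~ (G5 (aP y)^-1))); rewrite !GK => /(can_inj (mulmxK uO)).
  rewrite -[v]hsubmxK -[v']hsubmxK El; congr row_mx.
  move: Ep; rewrite El => /addIr /matrixP/(_ 0 0); rewrite !mxE eqxx !mulr1n.
  move=> /(mulIf (invr_neq0 A0)) /(fmorph_inj (real_complex R)) Er.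
  by apply/matrixP => i j; rewrite !ord1 [RHS]mxE [LHS]mxE.
rewrite /in_g -[xi]hsubmxK; set p := lsubmx xi; set q := rsubmx xi.
rewrite g_conj_row_mx => /eq_row_mx[cp cq].
have [w Ew] : exists w, toC w = q *m G5 (aP y)^-1 *m invmx (Om k (xP y)).
  apply: real_mx; rewrite !conjmxM conj_G5 conj_invmx //.
  (* The permutation produced by conjugating [q] cancels the one from the inverse of omega_4, after
     passing through [G5], where zeta and zetabar have equal weight. *)
  by rewrite -[in RHS]cq -!mulmxA; congr (_ *m _); rewrite !mulmxA G5_swap.
have [r Er] : exists r, toC r = (aP y)%:C%C *: (p + toC w *m lam k (xP y)).
  apply: real_mx; rewrite conjmxZ conjmxD conjmxM conj_toC cl cp conjc_real.
  by [].
suff wr : cartan_form D Lam k y (row_mx w r) = row_mx p q.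
  by exists (row_mx w r); split=> // v vE; apply: inj; rewrite vE.
rewrite cartan_formE // row_mxKl row_mxKr Ew mulmxKV // GKV; congr row_mx.
have -> : (r 0 0)%:C%C = toC r 0 0 by rewrite mxE.
rewrite Er -Ew; apply/matrixP => i j; rewrite !ord1.
rewrite mxE [X in X + _]mxE [X in _ + X]mxE eqxx mulr1n.
rewrite [X in X / _]mxE [X in _ * X / _]mxE mulrAC mulfV // mul1r.
by rewrite addrK.
Qed.

End Connection.


Theorem theorem3 (R : realType) (M : smooth_manifold R 5) (L : CR_structure M)
  (hM : class_III2 L)
  (I : Type) (D : I -> adapted_generator L)
  (P : set (@coframe_pt R M)) (hP : is_P5 D P)
  (Lam : Pchart -> 'rV[R]_(5 + 1) -> 'cV[R[i]]_(5 + 1))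
  (hLam : is_Lambda D P Lam) :
  cartan_connection D P (cartan_form D Lam).
Proof.
move=> k u Pu [cu iu] y; pose x := coord k.1 u.1.
have [a a0 uE] : exists2 a : R, a != 0 & u = coframe (D k.2) a u.1.
  by apply/(hP.2 k.2 u iu).
have imx : im k.1 (gdom (D k.2)) x by exists u.1.
have Pcoord_act b : b != 0 -> Pcoord D k (act b u) = row_mx x (a * b)%:M.
  move=> b0; rewrite uE act_coframe /Pcoord /=.
  by rewrite (fibre_coord_coframe hM cu iu) ?mulf_neq0.
have yE : y = row_mx x a%:M.
  by rewrite /y {1}uE /Pcoord /= (fibre_coord_coframe hM cu iu).
have yk : Pim D k y by rewrite yE; exact: PimP.
split.
- by move=> v; exact: (cartan_form_real hM hLam).
(* The orbit reads s |-> (x, a e^s), so its velocity at 0 is a d/da: da/a takes the value 1 on it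
   and the forms pulled back from the base vanish. *)
- have -> : e_alpha_star D k u = row_mx 0 a%:M.
    apply/rowP => j; rewrite [LHS]mxE.
    have -> : (fun s : R => Pcoord D k (act (expR s) u) 0 j) =
        (fun s => row_mx x (a * expR s)%:M 0 j).
      by apply/funext => s; rewrite Pcoord_act // gt_eqF // expR_gt0.
    case: (split_ordP j) => l ->.
      rewrite row_mxEl mxE.
      have -> : (fun s : R => row_mx x (a * expR s)%:M 0 (lshift 1 l)) = cst (x 0 l).
        by apply/funext => s; rewrite row_mxEl.
      exact: derive1_cst.
    rewrite row_mxEr ord1 mxE eqxx mulr1n.
    have -> : (fun s : R => row_mx x (a * expR s)%:M 0 (rshift 5 0)) = a \*: @expR R.
      by apply/funext => s; rewrite row_mxEr mxE eqxx mulr1n.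
    have [_ da] := is_deriveZ a (is_derive_expR (0 : R)).
    by rewrite derive1E da expR0 /GRing.scale /= mulr1.
  rewrite (cartan_formE hM hLam) // row_mxKl row_mxKr yE /aP row_mxKr !mxE eqxx.
  have -> : toC (0 : 'rV[R]_5) = 0 by apply/matrixP => i j; rewrite !mxE.
  have A0 : a%:C%C != 0 :> R[i] by rewrite fmorph_eq0.
  by rewrite !mul0mx subr0 mulr1n divff // e_alphaE.
- move=> b b0 v; rewrite Pcoord_act //.
  rewrite (mulmx_jacobian (B := block_mx 1%:M 0 0 b%:M)) ?yE.
    exact: (cartan_form_equivariant hM hLam).
  (* Since [Pim] is open, the linear expression of the right action holds near [y], as the Jacobian
     requires. *)
  rewrite -yE; apply: filterS (nbhs_Pim yk) => z zk.
  by rewrite (R_chartE hM).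
- split=> [t v w|xi xig]; last exact: (cartan_form_bij hM hLam).
  have toCD (v' w' : 'rV[R]_(5 + 1)) : toC (t *: v' + w') = t%:C%C *: toC v' + toC w'.
    by apply/matrixP => i j; rewrite !mxE rmorphD rmorphM.
  by rewrite /cartan_form toCD mulmxDl scalemxAl.
Qed.
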